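(* Let $\mathcal A$ be an abelian category with enough projectives. (i) $\mathcal A$ is Gorenstein (resp. Gorenstein of finite CM-type) if and only if $\mathrm{GProj}\,\mathcal A$ admits a resolving subcategory $\mathcal X$ (resp. a resolving subcategory $\mathcal X$ of finite representation type) such that $\mathrm{res.dim}_{\mathcal X}\mathcal A<\infty$. (ii) If $\mathcal A$ is $R$-linear over a commutative ring $R$ and the $R$-module $\mathcal A(A,B)$ is finitely generated for all $A,B\in\mathcal A$, then the following are equivalent: (a) $\mathcal A$ is Gorenstein of finite CM-type. (b) $\mathrm{GProj}\,\mathcal A$ admits a resolving subcategory $\mathcal X$ of finite representation type such that $\mathrm{gl.dim}\,\mathsf A(\mathcal X)<\infty$.
   Context: An acyclic complex $P^\bullet$ of projective objects of $\mathcal A$ is totally acyclic if $\mathcal A(P^\bullet,P)$ is acyclic for every projective $P$; an object is Gorenstein-projective if it is $\mathrm{Coker}(P^{-1}\to P^0)$ for such a $P^\bullet$; $\mathrm{GProj}\,\mathcal A$ is the full subcategory of these. A full subcategory $\mathcal X\subseteq\mathcal A$ is resolving if it contains the projectives, is closed under extensions and kernels of epimorphisms, and (tacit convention) under direct summands; ''$\mathrm{GProj}\,\mathcal A$ admits a resolving subcategory $\mathcal X$'' means that there is a resolving subcategory $\mathcal X$ of $\mathcal A$ with $\mathcal X\subseteq\mathrm{GProj}\,\mathcal A$. $\mathrm{res.dim}_{\mathcal X}A$ is the minimal $n$ with an exact sequence $0\to X_n\to\cdots\to X_0\to A\to0$, $X_i\in\mathcal X$ ($\infty$ if none exists), and $\mathrm{res.dim}_{\mathcal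 X}\mathcal A=\sup_{A\in\mathcal A}\mathrm{res.dim}_{\mathcal X}A$. $\mathcal A$ is Gorenstein if $\mathrm{res.dim}_{\mathrm{GProj}\,\mathcal A}\mathcal A<\infty$. A subcategory is of finite representation type if it is a skeletally small Krull-Schmidt category (every object is a finite coproduct of indecomposables with local endomorphism rings) with finitely many isomorphism classes of indecomposables; then it equals $\mathrm{add}\,T$ for some object $T$, where $\mathrm{add}\,T$ denotes direct summands of finite coproducts of copies of $T$. $\mathcal A$ is of finite CM-type if $\mathrm{GProj}\,\mathcal A$ is of finite representation type. For $\mathcal X=\mathrm{add}\,T$, $\mathsf A(\mathcal X)=\mathrm{End}_{\mathcal A}(T)^{\mathrm{op}}$, and $\mathrm{gl.dim}\,\mathsf A(\mathcal X)$ is the global dimension of the category of finitely presented $\mathsf A(\mathcal X)$-modules, equivalently of coherent functors $\mathcal X^{\mathrm{op}}\to\mathrm{Ab}$ (functors $F$ with an exact sequence $\mathcal X(-,X_1)\to\mathcal X(-,X_0)\to F\to0$), which is abelian in the situation of (ii). *)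

(* Defs.v *)
From HB Require Import structures.
From mathcomp Require Import all_boot all_order all_algebra.

Set Implicit Arguments.
Unset Strict Implicit.
Unset Printing Implicit Defensive.

Import GRing.Theory.
Local Open Scope ring_scope.

(** * Preadditive and abelian categories *)

Record preadditive := Preadditive {
  obj :> Type;
  hom : obj -> obj -> zmodType;
  idm : forall A, hom A A;
  comp : forall A B D, hom B D -> hom A B -> hom A D;
  compA : forall A B D E (h : hom D E) (g : hom B D) (f : hom A B),
    comp h (comp g f) = comp (comp h g) f;
  comp1m : forall A B (f : hom A B), comp (idm B) f = f;
  compm1 : forall A B (f : hom A B), comp f (idm A) = f;
  compDl : forall A B D (g h : hom B D) (f : hom A B),
    comp (g + h) f = comp g f + comp h f;
  compDr : forall A B D (g : hom B D) (f h : hom A B),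
    comp g (f + h) = comp g f + comp g h
}.

Arguments hom {_} A B.
Arguments idm {_} A.
Arguments comp {_ A B D} g f.

Notation "g \oc f" := (comp g f) (at level 40, left associativity).

Definition is_iso (C : preadditive) (A B : C) (f : hom A B) : Prop :=
  exists g : hom B A, g \oc f = idm A /\ f \oc g = idm B.

Definition isomorphic (C : preadditive) (A B : C) : Prop :=
  exists f : hom A B, is_iso f.

Definition mono (C : preadditive) (A B : C) (f : hom A B) : Prop :=
  forall (D : C) (g h : hom D A), f \oc g = f \oc h -> g = h.

Definition epi (C : preadditive) (A B : C) (f : hom A B) : Prop :=
  forall (D : C) (g h : hom B D), g \oc f = h \oc f -> g = h.

(* Initial and terminal; morphisms always exist, namely the zero ones. *)
Definition zero_object (C : preadditive) (Z : C) : Prop :=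
  forall B : C, (forall f : hom Z B, f = 0) /\ (forall f : hom B Z, f = 0).

Definition is_kernel (C : preadditive) (K A B : C) (f : hom A B)
    (k : hom K A) : Prop :=
  f \oc k = 0 /\
  forall (D : C) (h : hom D A), f \oc h = 0 -> exists! u : hom D K, k \oc u = h.

Definition is_cokernel (C : preadditive) (A B Q : C) (f : hom A B)
    (c : hom B Q) : Prop :=
  c \oc f = 0 /\
  forall (D : C) (h : hom B D), h \oc f = 0 -> exists! u : hom Q D, u \oc c = h.

Definition is_image (C : preadditive) (I A B : C) (f : hom A B)
    (m : hom I B) : Prop :=
  exists (Q : C) (c : hom B Q), is_cokernel f c /\ is_kernel c m.

(* Finite direct sums, which in a preadditive category are the same as finite
   coproducts; being equational, the notion does not depend on the full
   subcategory in which it is considered. *)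
Definition is_direct_sum (C : preadditive) (n : nat) (F : 'I_n -> C) (S : C) :
    Prop :=
  exists (inj : forall i, hom (F i) S) (prj : forall i, hom S (F i)),
    [/\ forall i, prj i \oc inj i = idm (F i),
        forall i j, i != j -> prj i \oc inj j = 0
      & \sum_(i < n) (inj i \oc prj i) = idm S].

Definition is_direct_sum2 (C : preadditive) (A B S : C) : Prop :=
  exists (iA : hom A S) (iB : hom B S) (pA : hom S A) (pB : hom S B),
    [/\ pA \oc iA = idm A, pB \oc iB = idm B, pA \oc iB = 0, pB \oc iA = 0
      & iA \oc pA + iB \oc pB = idm S].

Definition direct_summand (C : preadditive) (A S : C) : Prop :=
  exists B : C, is_direct_sum2 A B S.

Record abelian (C : preadditive) : Prop := Abelian {
  abelian_zero : exists Z : C, zero_object Z;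
  abelian_sum : forall A B : C, exists S : C, is_direct_sum2 A B S;
  abelian_ker : forall (A B : C) (f : hom A B),
    exists (K : C) (k : hom K A), is_kernel f k;
  abelian_coker : forall (A B : C) (f : hom A B),
    exists (Q : C) (c : hom B Q), is_cokernel f c;
  abelian_mono : forall (A B : C) (f : hom A B), mono f ->
    exists (D : C) (g : hom B D), is_kernel g f;
  abelian_epi : forall (A B : C) (f : hom A B), epi f ->
    exists (D : C) (g : hom D A), is_cokernel g f
}.

(* Im f = Ker g as subobjects of B. *)
Definition exact (C : preadditive) (A B D : C) (f : hom A B) (g : hom B D) :
    Prop :=
  exists (K : C) (k : hom K B), is_image f k /\ is_kernel g k.

Definition short_exact (C : preadditive) (A B D : C) (f : hom A B)
    (g : hom B D) : Prop :=
  [/\ mono f, exact f g & epi g].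

Definition projective (C : preadditive) (P : C) : Prop :=
  forall (A B : C) (e : hom A B) (f : hom P B), epi e ->
    exists g : hom P A, e \oc g = f.

Definition enough_projectives (C : preadditive) : Prop :=
  forall A : C, exists (P : C) (e : hom P A), projective P /\ epi e.

(** * Gorenstein-projective objects *)

Record complex (C : preadditive) := Complex {
  cobj :> int -> C;
  diff : forall i : int, hom (cobj i) (cobj (i + 1));
  diff2 : forall i : int, diff (i + 1) \oc diff i = 0
}.

Arguments diff {C} c i.

Definition acyclic (C : preadditive) (P : complex C) : Prop :=
  forall i : int, exact (diff P i) (diff P (i + 1)).

(* Acyclicity of the complex of abelian groups C(P, Q):
   C(P^(i+2), Q) -> C(P^(i+1), Q) -> C(P^i, Q) is exact for all i. *)
Definition hom_acyclic (C : preadditive) (P : complex C) (Q : C) : Prop :=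
  forall (i : int) (u : hom (P (i + 1)) Q),
    u \oc diff P i = 0 <->
    exists v : hom (P (i + 1 + 1)) Q, v \oc diff P (i + 1) = u.

Definition totally_acyclic (C : preadditive) (P : complex C) : Prop :=
  [/\ forall i : int, projective (P i), acyclic P
    & forall Q : C, projective Q -> hom_acyclic P Q].

Definition gproj (C : preadditive) (G : C) : Prop :=
  exists (P : complex C) (c : hom (P 0) G),
    totally_acyclic P /\ is_cokernel (diff P (- 1)) c.

(** * Full subcategories, given by predicates on objects *)

Definition subcategory_of (C : preadditive) (X Y : C -> Prop) : Prop :=
  forall A : C, X A -> Y A.

Record resolving (C : preadditive) (X : C -> Prop) : Prop := Resolving {
  resolving_proj : forall P : C, projective P -> X P;
  resolving_ext : forall (A B D : C) (f : hom A B) (g : hom B D),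
    short_exact f g -> X A -> X D -> X B;
  resolving_ker : forall (A B D : C) (f : hom A B) (g : hom B D),
    short_exact f g -> X B -> X D -> X A;
  resolving_summand : forall A B : C, direct_summand A B -> X B -> X A
}.

(* An exact sequence 0 -> X_n -> ... -> X_0 -> A -> 0 with all X_i in X,
   extended by zero objects in degrees greater than n. *)
Definition has_resolution (C : preadditive) (X : C -> Prop) (A : C) (n : nat) :
    Prop :=
  exists (F : nat -> C) (d : forall i, hom (F i.+1) (F i)) (e : hom (F 0%N) A),
    [/\ forall i, (i <= n)%N -> X (F i),
        forall i, (n < i)%N -> zero_object (F i),
        epi e, exact (d 0%N) e
      & forall i, exact (d i.+1) (d i)].

Definition resdim_le (C : preadditive) (X : C -> Prop) (A : C) (n : nat) :
    Prop :=
  exists2 m, (m <= n)%N & has_resolution X A m.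

(* The supremum over all objects of their resolution dimensions is finite. *)
Definition finite_resdim (C : preadditive) (X : C -> Prop) : Prop :=
  exists n : nat, forall A : C, resdim_le X A n.

Definition gorenstein (C : preadditive) : Prop := finite_resdim (@gproj C).

(** * Finite representation type *)

Definition indecomposable (C : preadditive) (X : C -> Prop) (A : C) : Prop :=
  [/\ X A, ~ zero_object A
    & forall B D : C, X B -> X D -> is_direct_sum2 B D A ->
        zero_object B \/ zero_object D].

(* The endomorphism ring is nonzero and sums of nonunits are nonunits. *)
Definition local_end (C : preadditive) (A : C) : Prop :=
  idm A <> 0 /\
  forall f g : hom A A, is_iso (f + g) -> is_iso f \/ is_iso g.

Definition krull_schmidt (C : preadditive) (X : C -> Prop) : Prop :=
  forall A : C, X A ->
    exists (n : nat) (F : 'I_n -> C),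
      (forall i, indecomposable X (F i) /\ local_end (F i)) /\
      is_direct_sum F A.

(* Smallness means being indexed by a type in Set; under the other two
   conditions of finite representation type this is no restriction. *)
Definition skeletally_small (C : preadditive) (X : C -> Prop) : Prop :=
  exists (I : Set) (F : I -> C), forall A : C, X A ->
    exists i : I, isomorphic A (F i).

Definition finite_rep_type (C : preadditive) (X : C -> Prop) : Prop :=
  [/\ skeletally_small X, krull_schmidt X
    & exists (n : nat) (F : 'I_n -> C), forall A : C, indecomposable X A ->
        exists i, isomorphic A (F i)].

Definition finite_CM_type (C : preadditive) : Prop :=
  finite_rep_type (@gproj C).

(* add T: direct summands of finite direct sums of copies of T. *)
Definition add_closure (C : preadditive) (T A : C) : Prop :=
  exists (n : nat) (S : C),
    is_direct_sum (fun _ : 'I_n => T) S /\ direct_summand A S.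

(** * The ring End(T)^op *)

Definition End (C : preadditive) (T : C) : Type := hom T T.

HB.instance Definition _ (C : preadditive) (T : C) :=
  GRing.Zmodule.on (@End C T).
HB.instance Definition _ (C : preadditive) (T : C) :=
  GRing.Zmodule_isPzRing.Build (@End C T)
    (fun h g f : hom T T => compA h g f) (fun f : hom T T => comp1m f)
    (fun f : hom T T => compm1 f) (fun g h f : hom T T => compDl g h f)
    (fun g f h : hom T T => compDr g f h).

(* Left modules over the converse ring are right End(T)-modules; for
   X = add T these are the additive functors X^op -> Ab, evaluated at T. *)
Definition endo_op (C : preadditive) (T : C) : pzRingType := (End T)^c.

(** * Global dimension of finitely presented modules *)

Definition lin_exact (S : pzRingType) (M N L : lmodType S)
    (f : {linear M -> N}) (g : {linear N -> L}) : Prop :=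
  forall y : N, g y = 0 <-> exists x : M, f x = y.

Definition lin_surj (S : pzRingType) (M N : lmodType S) (f : {linear M -> N}) :
    Prop :=
  forall y : N, exists x : M, f x = y.

Definition fin_presented (S : pzRingType) (M : lmodType S) : Prop :=
  exists (m n : nat) (f : {linear 'rV[S]_m -> 'rV[S]_n})
    (g : {linear 'rV[S]_n -> M}), lin_exact f g /\ lin_surj g.

(* Projective objects of the category of finitely presented modules, whose
   epimorphisms are the surjections (cokernels of finitely presented modules
   are finitely presented). *)
Definition fp_projective (S : pzRingType) (P : lmodType S) : Prop :=
  fin_presented P /\
  forall (M N : lmodType S) (e : {linear M -> N}) (f : {linear P -> N}),
    fin_presented M -> fin_presented N -> lin_surj e ->
    exists g : {linear P -> M}, forall x, e (g x) = f x.

(* When finitely presented modules form an abelian category, its kernels, and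
   hence its exact sequences, are the usual ones, since maps from the free
   module of rank one detect elements. *)
Definition has_proj_resolution (S : pzRingType) (M : lmodType S) (n : nat) :
    Prop :=
  exists (P : nat -> lmodType S) (d : forall i, {linear P i.+1 -> P i})
    (e : {linear P 0%N -> M}),
    [/\ forall i, (i <= n)%N -> fp_projective (P i),
        forall i, (n < i)%N -> forall x : P i, x = 0,
        lin_surj e, lin_exact (d 0%N) e
      & forall i, lin_exact (d i.+1) (d i)].

Definition finite_gldim (S : pzRingType) : Prop :=
  exists n : nat, forall M : lmodType S, fin_presented M ->
    exists2 m, (m <= n)%N & has_proj_resolution M m.

(** * Linear categories *)

Record linear_structure (R : comPzRingType) (C : preadditive) :=
  LinearStructure {
    hscale : forall A B : C, R -> hom A B -> hom A B;
    hscaleA : forall (A B : C) a b (f : hom A B),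
      hscale a (hscale b f) = hscale (a * b) f;
    hscale1 : forall (A B : C) (f : hom A B), hscale 1 f = f;
    hscaleDr : forall (A B : C) a (f g : hom A B),
      hscale a (f + g) = hscale a f + hscale a g;
    hscaleDl : forall (A B : C) a b (f : hom A B),
      hscale (a + b) f = hscale a f + hscale b f;
    hscale_compl : forall (A B D : C) a (g : hom B D) (f : hom A B),
      hscale a g \oc f = hscale a (g \oc f);
    hscale_compr : forall (A B D : C) a (g : hom B D) (f : hom A B),
      g \oc hscale a f = hscale a (g \oc f)
  }.

Arguments hscale {R C} _ {A B} a f.

Definition hom_fin_generated (R : comPzRingType) (C : preadditive)
    (L : linear_structure R C) (A B : C) : Prop :=
  exists (n : nat) (g : 'I_n -> hom A B), forall f : hom A B,
    exists a : 'I_n -> R, f = \sum_(i < n) hscale L (a i) (g i).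

(* Main.v *)
(* Exactness in C is tested on morphisms out of projective objects, so that
   diagrams are chased with elements.  GProj C is the largest class of objects G
   with Ext^1(G, Proj) = 0 having both a projective presentation and a
   projective copresentation whose ends stay in the class; coinduction with this
   description shows that it is resolving.  If a resolving subcategory X of
   GProj C has res.dim_X C <= n, then n-th syzygies lie in X; as every
   Gorenstein-projective object is an n-th syzygy, X = GProj C.
   If X = add T and Hom groups are finitely generated over R, every object has
   right X-approximations, Hom(T, -) identifies X with the finitely presented
   projective modules over End(T)^op, and it preserves and detects X-resolutions
   built from approximations.  Iterated kernels of approximations turn
   res.dim_X C <= n into gl.dim <= n + 2, and projective resolutions of the
   modules Hom(T, A) come from X-resolutions of A.  *)

From HB Require Import structures.
From mathcomp Require Import all_boot all_order all_algebra boolp.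
Require Import Defs.

Set Implicit Arguments.
Unset Strict Implicit.
Unset Printing Implicit Defensive.

Import GRing.Theory.
Local Open Scope ring_scope.

(** * Infinite sequences by dependent choice *)

Lemma nat_sequence (T : Type) (Z : T -> Prop) (R : T -> T -> Prop) (x0 : T) :
  (forall x, Z x -> exists2 y, Z y & R x y) -> Z x0 ->
  exists u : nat -> T,
    [/\ u 0%N = x0, forall n, Z (u n) & forall n, R (u n) (u n.+1)].
Proof.
move=> step Z0.
(* Outside [Z] the value is arbitrary, so that the choice function is total and can be iterated. *)
have /choice [f Hf] : forall x, exists y, Z x -> Z y /\ R x y.
  move=> x; have [/step [y Zy Rxy] | nZ] := pselect (Z x); last by exists x.
  by exists y.
have Zu n : Z (iter n f x0) by elim: n => //= n /Hf [].
by exists (fun n => iter n f x0); split=> // n; have [] := Hf _ (Zu n).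
Qed.

(** Two one-sided sequences from [x0] are glued. The start has index 1 because, with a projective in
    degree i between terms i and i + 1, the quotient of the projective in degree 0 is term 1. *)
Lemma int_sequence (T : Type) (Z : T -> Prop) (R : T -> T -> Prop) (x0 : T) :
  (forall x, Z x -> exists2 y, Z y & R x y) ->
  (forall x, Z x -> exists2 y, Z y & R y x) -> Z x0 ->
  exists u : int -> T,
    [/\ u 1 = x0, forall i, Z (u i) & forall i, R (u i) (u (i + 1))].
Proof.
move=> stepr stepl Z0.
have [u [u0 Zu Ru]] := nat_sequence stepr Z0.
have [v [v0 Zv Rv]] := nat_sequence (R := fun x y => R y x) stepl Z0.
pose w i := match i with Posz n => u n | Negz n => v n.+1 end.
have Zw i : Z (w i) by case: i => n; [exact: Zu | exact: Zv].
have Rw i : R (w i) (w (i + 1)).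
  case: i => [n|[|n]].
    have -> : Posz n + 1 = Posz n.+1 by rewrite -addn1.
    exact: Ru.
    by have := Rv 0%N; rewrite v0 -u0.
  have -> : Negz n.+1 + 1 = Negz n by rewrite !NegzE -(addn1 n.+1) PoszD opprD
    addrNK.
  exact: Rv.
exists (fun i => w (i - 1)); split=> // i; have := Rw (i - 1).
by rewrite addrAC.
Qed.

(** * Diagram chasing with generalized elements *)

Section Preadditive.
Variable C : preadditive.
Implicit Types A B D Z : C.

Lemma comp0m A B D (f : hom A B) : (0 : hom B D) \oc f = 0.
Proof. by apply: (addrI (0 \oc f)); rewrite -compDl !addr0. Qed.

Lemma compm0 A B D (f : hom B D) : f \oc (0 : hom A B) = 0.
Proof. by apply: (addrI (f \oc 0)); rewrite -compDr !addr0. Qed.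

Lemma compNl A B D (g : hom B D) (f : hom A B) : (- g) \oc f = - (g \oc f).
Proof. by apply: (addrI (g \oc f)); rewrite -compDl !subrr comp0m. Qed.

Lemma compNr A B D (g : hom B D) (f : hom A B) : g \oc (- f) = - (g \oc f).
Proof. by apply: (addrI (g \oc f)); rewrite -compDr !subrr compm0. Qed.

Lemma comp_suml A B D I (r : seq I) (P : pred I) (F : I -> hom B D)
    (f : hom A B) :
  (\sum_(i <- r | P i) F i) \oc f = \sum_(i <- r | P i) (F i \oc f).
Proof.
exact: (big_morph (fun g => g \oc f) (fun g h => compDl g h f) (comp0m _ f)).
Qed.

Lemma comp_sumr A B D I (r : seq I) (P : pred I) (g : hom B D)
    (F : I -> hom A B) :
  g \oc (\sum_(i <- r | P i) F i) = \sum_(i <- r | P i) (g \oc F i).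
Proof. exact: (big_morph (comp g) (compDr g) (compm0 _ g)). Qed.

Lemma monoP A B (f : hom A B) :
  mono f <-> forall D (x : hom D A), f \oc x = 0 -> x = 0.
Proof.
split=> [mf D x fx | f0 D x y e]; first by apply: mf; rewrite compm0.
by apply/subr0_eq/f0; rewrite compDr compNr e subrr.
Qed.

Lemma epiP A B (f : hom A B) :
  epi f <-> forall D (x : hom B D), x \oc f = 0 -> x = 0.
Proof.
split=> [ef D x fx | f0 D x y e]; first by apply: ef; rewrite comp0m.
by apply/subr0_eq/f0; rewrite compDl compNl e subrr.
Qed.

Lemma kernel_mono K A B (f : hom A B) (k : hom K A) : is_kernel f k -> mono k.
Proof.
move=> [fk uk]; apply/monoP=> D x kx.
have [u [_ uu]] := uk D 0 (compm0 _ _).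
by rewrite -(uu x kx) (uu 0 (compm0 _ _)).
Qed.

Lemma cokernel_epi A B Q (f : hom A B) (c : hom B Q) : is_cokernel f c -> epi c.
Proof.
move=> [fk uk]; apply/epiP=> D x kx.
have [u [_ uu]] := uk D 0 (comp0m _ _).
by rewrite -(uu x kx) (uu 0 (comp0m _ _)).
Qed.

Lemma kernel_comp0 K A B (f : hom A B) (k : hom K A) :
  is_kernel f k -> f \oc k = 0.
Proof. by case. Qed.

Lemma kernel_lift K A B (f : hom A B) (k : hom K A) D (h : hom D A) :
  is_kernel f k -> f \oc h = 0 -> exists u, k \oc u = h.
Proof. by move=> [_ uk] /uk [u [e _]]; exists u. Qed.

Lemma cokernel_desc A B Q (f : hom A B) (c : hom B Q) D (h : hom B D) :
  is_cokernel f c -> h \oc f = 0 -> exists u, u \oc c = h.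
Proof. by move=> [_ uk] /uk [u [e _]]; exists u. Qed.

Lemma kernelI K A B (f : hom A B) (k : hom K A) :
  mono k -> f \oc k = 0 ->
  (forall D (h : hom D A), f \oc h = 0 -> exists u, k \oc u = h) ->
  is_kernel f k.
Proof.
move=> mk fk lk; split=> // D h /lk [u e]; exists u; split=> // v e'.
by apply: mk; rewrite e.
Qed.

Lemma cokernelI A B Q (f : hom A B) (c : hom B Q) :
  epi c -> c \oc f = 0 ->
  (forall D (h : hom B D), h \oc f = 0 -> exists u, u \oc c = h) ->
  is_cokernel f c.
Proof.
move=> mk fk lk; split=> // D h /lk [u e]; exists u; split=> // v e'.
by apply: mk; rewrite e.
Qed.

Lemma zero_object_idm A : idm A = 0 -> zero_object A.
Proof.
move=> A0 B; split=> f; first by rewrite -(compm1 f) A0 compm0.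
by rewrite -(comp1m f) A0 comp0m.
Qed.

Lemma zero_dom Z A (f : hom Z A) : zero_object Z -> f = 0.
Proof. by move=> /(_ A) []. Qed.

Lemma zero_codom Z A (f : hom A Z) : zero_object Z -> f = 0.
Proof. by move=> /(_ A) []. Qed.

End Preadditive.
(** * The modules Hom(T, A) over the ring End(T)^op *)

(** A separate name for the group, so that the module structure attaches to it and not to every
    [hom]. *)
Definition hom_mod (C : preadditive) (T A : C) : Type := hom T A.

HB.instance Definition _ (C : preadditive) (T A : C) :=
  GRing.Zmodule.on (@hom_mod C T A).

(** Precomposition is a right action of End(T), hence a left action of the converse ring. *)
Definition precomp (C : preadditive) (T A : C) (a : endo_op T)
  (x : hom_mod T A) : hom_mod T A := (x : hom T A) \oc (a : hom T T).

Lemma precompA (C : preadditive) (T A : C) (a b : endo_op T)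
  (x : hom_mod T A) : precomp a (precomp b x) = precomp (a * b) x.
Proof. by rewrite /precomp -compA. Qed.

Lemma precomp1 (C : preadditive) (T A : C) : left_id 1 (@precomp C T A).
Proof. by move=> x; exact: compm1. Qed.

Lemma precompDr (C : preadditive) (T A : C) :
  right_distributive (@precomp C T A) +%R.
Proof. by move=> a x y; exact: compDl. Qed.

Lemma precompDl (C : preadditive) (T A : C) (x : hom_mod T A) :
  {morph (@precomp C T A)^~ x : a b / a + b}.
Proof. by move=> a b; exact: compDr. Qed.

HB.instance Definition _ (C : preadditive) (T A : C) :=
  GRing.Zmodule_isLmodule.Build (endo_op T) (@hom_mod C T A)
    (@precompA C T A) (@precomp1 C T A) (@precompDr C T A) (@precompDl C T A).

Lemma linear_map (S : pzRingType) (M N : lmodType S) (f : M -> N) :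
  linear f -> exists g : {linear M -> N}, forall x, g x = f x.
Proof.
move=> lf; pose F := GRing.isLinear.Build S M N *:%R f lf.
by exists (HB.pack_for {linear M -> N} f F).
Qed.

Lemma row_linear_map (S : pzRingType) (M : lmodType S) n (m : 'I_n -> M) :
  exists g : {linear 'rV[S]_n -> M}, forall v, g v = \sum_i v 0 i *: m i.
Proof.
apply: linear_map => a u v; rewrite scaler_sumr -big_split /=.
by apply: eq_bigr => i _; rewrite !mxE scalerDl scalerA.
Qed.

Section HomMod.
Variables (C : preadditive) (T : C).
Implicit Types A B D : C.

Lemma hom_mod_scale A (a : endo_op T) (x : hom_mod T A) :
  a *: x = (x : hom T A) \oc (a : hom T T).
Proof. by []. Qed.

Lemma postcomp_linear A B (f : hom A B) :
  exists g : {linear hom_mod T A -> hom_mod T B},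
    forall x : hom T A, g x = f \oc x.
Proof.
apply: (@linear_map _ (hom_mod T A) (hom_mod T B) (fun x => f \oc x)).
by move=> a x y; rewrite hom_mod_scale compDr compA.
Qed.

(* A retract of T^n, presented by the components of the two maps. *)
Definition coordinates A n (s : 'I_n -> hom A T)
  (p : 'I_n -> hom T A) : Prop := \sum_i p i \oc s i = idm A.

(** The [p i] generate Hom(T, A), the coefficients of [x] being [s i \oc x], so [h] is determined by
    its values on them. *)
Lemma linear_coordinates A n (s : 'I_n -> hom A T) p (M : lmodType (endo_op T))
    (h : {linear hom_mod T A -> M}) (x : hom_mod T A) :
  coordinates s p ->
  h x = \sum_i (s i \oc x : endo_op T) *: h (p i).
Proof.
move=> sp; under eq_bigr do rewrite -linearZ.
rewrite -linear_sum; congr (h _).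
rewrite -[LHS](comp1m (x : hom T A)) -sp comp_suml.
by apply: eq_bigr => i _; rewrite hom_mod_scale compA.
Qed.

(** Yoneda for retracts of T^n: the map [f] is the sum of the composites of [s i] with [h (p i)]. *)
Lemma yoneda A B n (s : 'I_n -> hom A T) p
    (h : {linear hom_mod T A -> hom_mod T B}) :
  coordinates s p ->
  exists f : hom A B, forall x : hom T A, h x = f \oc x.
Proof.
move=> sp; exists (\sum_i (h (p i) : hom T B) \oc s i) => x.
rewrite (linear_coordinates h x sp) comp_suml.
by apply: eq_bigr => i _; rewrite hom_mod_scale compA.
Qed.

(** Dual basis argument for the projectivity of Hom(T, A): lift the images of the generators [p i]
    and extend by the coordinates. *)
Lemma coordinates_lift A n (s : 'I_n -> hom A T) p
    (M N : lmodType (endo_op T)) (e : {linear M -> N})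
    (f : {linear hom_mod T A -> N}) :
  coordinates s p -> lin_surj e ->
  exists g : {linear hom_mod T A -> M}, forall x, e (g x) = f x.
Proof.
move=> sp se; have [m em] := choice (fun i => se (f (p i))).
have [|g eg] := @linear_map _ (hom_mod T A) M
  (fun x => \sum_i (s i \oc x : endo_op T) *: m i).
  move=> a x y; rewrite scaler_sumr -big_split /=; apply: eq_bigr => i _.
  by rewrite scalerA -scalerDl compDr compA.
exists g => x; rewrite eg linear_sum (linear_coordinates f x sp).
by apply: eq_bigr => i _; rewrite linearZ em.
Qed.

(** Finite generation of Hom(T, A) over End(T); the [g i] assemble to a map T^n -> A through which
    every map from T factors. *)
Definition hom_generated A : Prop :=
  exists n (g : 'I_n -> hom T A), forall x : hom T A,
    exists a : 'I_n -> hom T T, x = \sum_i g i \oc a i.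

Lemma fin_generated_hom (R : comPzRingType) (L : linear_structure R C) A :
  hom_fin_generated L T A -> hom_generated A.
Proof.
move=> [n [g Hg]]; exists n, g => x; have [a ->] := Hg x.
(* A scalar of R acts as the corresponding multiple of the identity of T. *)
exists (fun i => hscale L (a i) (idm T)); apply: eq_bigr => i _.
by rewrite hscale_compr compm1.
Qed.

End HomMod.

(** * Exactness in an abelian category, tested on projective objects *)

Section Abelian.
Variable C : preadditive.
Hypotheses (Cab : abelian C) (Cproj : enough_projectives C).
Implicit Types A B D P Q S Z : C.

(** An epimorphism is the cokernel of some g; as g factors through [k], maps killing [k] also kill
    g. *)
Lemma epi_cokernel_kernel A B K (e : hom A B) (k : hom K A) :
  epi e -> is_kernel e k -> is_cokernel k e.
Proof.
move=> ee ke; have [D [g ge]] := abelian_epi Cab ee.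
apply: cokernelI=> //; first exact: kernel_comp0 ke.
move=> E h hk; have [u eu] := kernel_lift ke (proj1 ge).
by apply: (cokernel_desc ge); rewrite -eu compA hk comp0m.
Qed.

Lemma mono_kernel_cokernel A B Q (m : hom A B) (c : hom B Q) :
  mono m -> is_cokernel m c -> is_kernel c m.
Proof.
move=> mm cm; have [D [g gm]] := abelian_mono Cab mm.
apply: kernelI=> //; first by case: cm.
move=> E h ch; have [u eu] := cokernel_desc cm (proj1 gm).
by apply: (kernel_lift gm); rewrite -eu -compA ch compm0.
Qed.

(** Let m be the kernel of the cokernel w of [f']. The mono k m is a kernel of some h; as h kills
    [f], it factors through [c] and kills [k]. Hence [k] factors through k m, so m has a right
    inverse and w = 0. *)
Lemma image_epi A B I Q (f : hom A B) (c : hom B Q) (k : hom I B)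
    (f' : hom A I) :
  is_cokernel f c -> is_kernel c k -> k \oc f' = f -> epi f'.
Proof.
move=> cf kc ef; have [W [w cw]] := abelian_coker Cab f'.
have [J [m km]] := abelian_ker Cab w.
have [f'' ef'] := kernel_lift km (proj1 cw).
have mkm : mono (k \oc m).
  apply/monoP=> D x; rewrite -compA => e.
  have /monoP mk := kernel_mono kc; have /monoP mm := kernel_mono km.
  exact/mm/mk.
have [E [h kh]] := abelian_mono Cab mkm.
have hf : h \oc f = 0 by rewrite -ef -ef' !compA -(compA h) (kernel_comp0 kh)
  comp0m.
have [h' eh] := cokernel_desc cf hf.
have hk : h \oc k = 0 by rewrite -eh -compA (kernel_comp0 kc) compm0.
have [t et] := kernel_lift kh hk.
have mt : m \oc t = idm I.
  by apply: (kernel_mono kc); rewrite compm1 compA.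
have w0 : w = 0 by rewrite -(compm1 w) -mt compA (kernel_comp0 km) comp0m.
apply/epiP=> D x xf; have [u <-] := cokernel_desc cw xf.
by rewrite w0 compm0.
Qed.

Lemma mono_projP A B (f : hom A B) :
  (forall P (x : hom P A), projective P -> f \oc x = 0 -> x = 0) -> mono f.
Proof.
move=> H; apply/monoP=> D x fx; have [P [e [Pp ee]]] := Cproj D.
have /epiP e0 := ee; apply: e0; apply: H => //.
by rewrite compA fx comp0m.
Qed.

Lemma epi_projP A B (f : hom A B) :
  (forall P (y : hom P B), projective P -> exists x, f \oc x = y) -> epi f.
Proof.
move=> H; have [P [e [Pp ee]]] := Cproj B; have [x ex] := H P e Pp.
apply/epiP=> D g gf; have /epiP e0 := ee; apply: e0.
by rewrite -ex compA gf comp0m.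
Qed.

(* Epimorphisms being cokernels, a lift of h : D -> A along k exists as soon as
   it does after precomposition with a projective cover of D. *)
Lemma kernel_projP K A B (f : hom A B) (k : hom K A) : f \oc k = 0 ->
  (forall P (x : hom P K), projective P -> k \oc x = 0 -> x = 0) ->
  (forall P (y : hom P A), projective P -> f \oc y = 0 ->
     exists x, k \oc x = y) ->
  is_kernel f k.
Proof.
move=> fk k0 kl; have mk := mono_projP k0; apply: kernelI => // D h fh.
have [P [e [Pp ee]]] := Cproj D.
have fhe : f \oc (h \oc e) = 0 by rewrite compA fh comp0m.
have [x ex] := kl P (h \oc e) Pp fhe.
have [N [n kn]] := abelian_ker Cab e.
have xn : x \oc n = 0.
  have /monoP := mk; apply.
  by rewrite compA ex -compA (kernel_comp0 kn) compm0.
have [u eu] := cokernel_desc (epi_cokernel_kernel ee kn) xn.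
by exists u; apply: ee; rewrite -compA eu ex.
Qed.

(** Maps from projectives lift along the epimorphism onto the image. Conversely, such lifts make the
    map from [A] to the kernel of [g] an epimorphism, so this kernel is the image of [f]. *)
Lemma exactP A B D (f : hom A B) (g : hom B D) :
  exact f g <-> g \oc f = 0 /\
    forall P (y : hom P B), projective P -> g \oc y = 0 -> exists x, f \oc x =
      y.
Proof.
split=> [[K [k [[Q [c [cf kc]]] kg]]] | [gf H]].
- have [f' ef] := kernel_lift kc (proj1 cf).
  have ef' := image_epi cf kc ef.
  split=> [|P y Pp gy]; first by rewrite -ef compA (kernel_comp0 kg) comp0m.
  have [y' ey] := kernel_lift kg gy; have [x ex] := Pp _ _ f' y' ef'.
  by exists x; rewrite -ef -compA ex.
- have [K [k kg]] := abelian_ker Cab g; have [f' ef] := kernel_lift kg gf.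
  have mk := kernel_mono kg.
  have ef' : epi f'.
    apply: epi_projP => P y Pp.
    have gky : g \oc (k \oc y) = 0 by rewrite compA (kernel_comp0 kg) comp0m.
    have [x ex] := H P _ Pp gky.
    by exists x; apply: mk; rewrite compA ef.
  have [Q [c ck]] := abelian_coker Cab k.
  exists K, k; split=> //; exists Q, c; split.
    apply: cokernelI; first exact: cokernel_epi ck.
      by rewrite -ef compA (proj1 ck) comp0m.
    move=> E h hf; apply: (cokernel_desc ck).
    by apply: ef'; rewrite comp0m -compA ef.
  exact: mono_kernel_cokernel.
Qed.

(** Exactness as a universal property, so that maps from arbitrary objects factor, not only those
    from projectives. *)
Definition ses A B D (f : hom A B) (g : hom B D) : Prop :=
  is_kernel g f /\ epi g.

Lemma ses_short_exact A B D (f : hom A B) (g : hom B D) :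
  ses f g <-> short_exact f g.
Proof.
split=> [[kf eg] | [mf /exactP [gf H] eg]].
- split=> //; first exact: kernel_mono kf.
  apply/exactP; split=> [|P y _]; first exact: kernel_comp0 kf.
  exact: (kernel_lift kf).
- split=> //; apply: kernel_projP => // P x Pp fx.
  by move/monoP: mf; apply.
Qed.

Lemma sesI A B D (f : hom A B) (g : hom B D) : g \oc f = 0 ->
  (forall P (x : hom P A), projective P -> f \oc x = 0 -> x = 0) ->
  (forall P (y : hom P B), projective P -> g \oc y = 0 ->
     exists x, f \oc x = y) ->
  (forall P (z : hom P D), projective P -> exists y, g \oc y = z) ->
  ses f g.
Proof. by move=> *; split; [exact: kernel_projP | exact: epi_projP]. Qed.

Section SesTheory.
Variables (A B D : C) (f : hom A B) (g : hom B D).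
Hypothesis fg : ses f g.

Lemma ses_comp0 : g \oc f = 0.
Proof. exact: kernel_comp0 (proj1 fg). Qed.

Lemma ses_mono0 E (x : hom E A) : f \oc x = 0 -> x = 0.
Proof. by move: E x; apply/monoP; apply: kernel_mono (proj1 fg). Qed.

Lemma ses_mono E (x y : hom E A) : f \oc x = f \oc y -> x = y.
Proof. by move=> /(kernel_mono (proj1 fg)). Qed.

Lemma ses_lift E (y : hom E B) : g \oc y = 0 -> exists x, f \oc x = y.
Proof. exact: (kernel_lift (proj1 fg)). Qed.

Lemma ses_epi E (x y : hom D E) : x \oc g = y \oc g -> x = y.
Proof. exact: (proj2 fg). Qed.

Lemma ses_plift P (y : hom P D) : projective P -> exists x, g \oc x = y.
Proof. by move=> Pp; apply: Pp; case: fg. Qed.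

Lemma ses_cokernel : is_cokernel f g.
Proof. by case: fg => kf eg; exact: epi_cokernel_kernel. Qed.

Lemma ses_desc E (y : hom B E) : y \oc f = 0 -> exists x, x \oc g = y.
Proof. exact: (cokernel_desc ses_cokernel). Qed.

End SesTheory.

Lemma epi_ses A B (e : hom A B) : epi e -> exists K (k : hom K A), ses k e.
Proof. by move=> ee; have [K [k kk]] := abelian_ker Cab e; exists K, k. Qed.

Lemma mono_ses A B (m : hom A B) : mono m -> exists Q (q : hom B Q), ses m q.
Proof.
move=> mm; have [Q [q qm]] := abelian_coker Cab m; exists Q, q.
split; first exact: mono_kernel_cokernel.
exact: cokernel_epi qm.
Qed.

Lemma proj_ses A : exists K P (k : hom K P) (e : hom P A),
  projective P /\ ses k e.
Proof.
have [P [e [Pp /epi_ses [K [k ke]]]]] := Cproj A.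
by exists K, P, k, e.
Qed.

Lemma iso_ses A B D (f : hom A B) (g : hom B D) :
  zero_object A -> ses f g -> is_iso g.
Proof.
move=> A0 fg.
have f0 : idm B \oc f = 0 by exact: zero_dom.
have [h hg] := ses_desc fg f0.
by exists h; split=> //; apply: (ses_epi fg); rewrite -compA hg compm1 comp1m.
Qed.

(** The complement is the kernel of [p], onto which the idempotent 1 - s p projects. *)
Lemma retract_summand A S (s : hom A S) (p : hom S A) :
  p \oc s = idm A -> direct_summand A S.
Proof.
move=> ps; have [B [k kp]] := abelian_ker Cab p.
have e0 : p \oc (idm S - s \oc p) = 0.
  by rewrite compDr compNr compm1 compA ps comp1m subrr.
have [r er] := kernel_lift kp e0.
exists B, s, k, p, r; split=> //.
- apply: (kernel_mono kp).
  by rewrite compA er compDl compNl comp1m compm1 -compA (kernel_comp0 kp)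
    compm0 subr0.
- exact: kernel_comp0 kp.
- apply: (kernel_mono kp).
  by rewrite compA er compDl compNl comp1m compm0 -compA ps compm1 subrr.
- by rewrite er addrC subrK.
Qed.

Lemma sum2_ses A B S (iA : hom A S) (iB : hom B S) (pA : hom S A)
    (pB : hom S B) :
  [/\ pA \oc iA = idm A, pB \oc iB = idm B, pA \oc iB = 0, pB \oc iA = 0
    & iA \oc pA + iB \oc pB = idm S] -> ses iA pB.
Proof.
move=> [AA BB AB BA e]; apply: sesI => // [P x _ x0 | P y _ y0 | P z _].
- by rewrite -(comp1m x) -AA -compA x0 compm0.
- by exists (pA \oc y); rewrite -[RHS]comp1m -e compDl -!compA y0 compm0 addr0.
- by exists (iB \oc z); rewrite compA BB comp1m.
Qed.

Lemma projective_sum2 P Q S : projective P -> projective Q ->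
  is_direct_sum2 P Q S -> projective S.
Proof.
move=> Pp Qp [i [j [p [q [_ _ _ _ e]]]]] A B g f eg.
have [x ex] := Pp _ _ g (f \oc i) eg; have [y ey] := Qp _ _ g (f \oc j) eg.
exists (x \oc p + y \oc q).
by rewrite compDr !compA ex ey -!compA -compDr e compm1.
Qed.

Lemma projective_zero Z : zero_object Z -> projective Z.
Proof.
by move=> Z0 A B e f _; exists 0; rewrite compm0 (zero_dom f).
Qed.

(** * Horseshoe lemmas *)

(** The map [q] is f a on PA and a lift of [b] through [g] on PD; a chase then shows that the three
    kernels form a short exact sequence. *)
Lemma horseshoe A B D KA PA KD PD (f : hom A B) (g : hom B D)
    (kA : hom KA PA) (a : hom PA A) (kD : hom KD PD) (b : hom PD D) :
  ses f g -> ses kA a -> ses kD b -> projective PD ->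
  exists K S (k : hom K S) (q : hom S B) (u : hom KA K) (v : hom K KD),
    [/\ is_direct_sum2 PA PD S, ses k q & ses u v].
Proof.
move=> fg sA sD PDp.
have [S HS] := abelian_sum Cab PA PD.
have [iA [iD [pA [pD [AA DD AD DA e]]]]] := HS.
have [s es] := ses_plift fg b PDp.
pose q := f \oc a \oc pA + s \oc pD.
have qA : q \oc iA = f \oc a.
  by rewrite compDl -!compA AA DA !compm0 addr0 compm1.
have qD : q \oc iD = s.
  by rewrite compDl -!compA AD DD !compm0 add0r compm1.
have gq : g \oc q = b \oc pD.
  by rewrite compDr !compA (ses_comp0 fg) !comp0m add0r es.
have eq : epi q.
  apply: epi_projP => P y Pp.
  have [z ez] := ses_plift sD (g \oc y) Pp.
  have : g \oc (y - s \oc z) = 0.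
    by rewrite compDr compNr compA es ez subrr.
  move=> /(ses_lift fg) [w ew]; have [x ex] := ses_plift sA w Pp.
  exists (iA \oc x + iD \oc z).
  by rewrite compDr !compA qA qD -compA ex ew subrK.
have [K [k kq]] := epi_ses eq.
have : q \oc (iA \oc kA) = 0.
  by rewrite compA qA -compA (ses_comp0 sA) compm0.
move=> /(ses_lift kq) [u eu].
have : b \oc (pD \oc k) = 0.
  by rewrite compA -gq -compA (ses_comp0 kq) compm0.
move=> /(ses_lift sD) [v ev].
exists K, S, k, q, u, v; split=> //; apply: sesI.
- by apply: (ses_mono sD); rewrite compA ev -compA eu compA DA comp0m compm0.
- move=> P x Pp ux; apply: (ses_mono0 sA).
  by rewrite -[LHS]comp1m -AA -compA (compA iA) -eu -compA ux !compm0.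
- move=> P y Pp vy.
  have pDy : pD \oc (k \oc y) = 0 by rewrite compA -ev -compA vy compm0.
  have ky : k \oc y = iA \oc (pA \oc (k \oc y)).
    by rewrite -[LHS]comp1m -e compDl -!compA pDy compm0 addr0.
  have : a \oc (pA \oc (k \oc y)) = 0.
    apply: (ses_mono0 fg).
    by rewrite compA -qA -compA -ky compA (ses_comp0 kq) comp0m.
  move=> /(ses_lift sA) [x ex]; exists x; apply: (ses_mono kq).
  by rewrite compA eu -compA ex -ky.
- move=> P z Pp.
  have : g \oc (s \oc (kD \oc z)) = 0.
    by rewrite !compA es (ses_comp0 sD) comp0m.
  move=> /(ses_lift fg) [w ew]; have [x ex] := ses_plift sA w Pp.
  have : q \oc (iD \oc (kD \oc z) - iA \oc x) = 0.
    by rewrite compDr compNr !compA qA qD -(compA f a) ex ew compA subrr.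
  move=> /(ses_lift kq) [y ey]; exists y; apply: (ses_mono sD).
  rewrite compA ev -compA ey compDr compNr !compA DD DA !comp0m subr0.
  by rewrite comp1m.
Qed.

(** Dual to [horseshoe]: the given extension [r] of [a] along [f] takes the place of injectivity of
    [PA]. *)
Lemma cohorseshoe A B D QA PA QD PD (f : hom A B) (g : hom B D)
    (a : hom A PA) (a' : hom PA QA) (b : hom D PD) (b' : hom PD QD)
    (r : hom B PA) :
  ses f g -> ses a a' -> ses b b' -> r \oc f = a ->
  exists Q S (j : hom B S) (q : hom S Q) (u : hom QA Q) (v : hom Q QD),
    [/\ is_direct_sum2 PA PD S, ses j q & ses u v].
Proof.
move=> fg sA sD er.
have [S HS] := abelian_sum Cab PA PD.
have [iA [iD [pA [pD [AA DD AD DA e]]]]] := HS.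
pose j := iA \oc r + iD \oc (b \oc g).
have pAj : pA \oc j = r.
  by rewrite compDr !compA AA AD comp1m !comp0m addr0.
have pDj : pD \oc j = b \oc g.
  by rewrite compDr !compA DA DD comp1m !comp0m add0r.
have jf : j \oc f = iA \oc a.
  by rewrite compDl -!compA (ses_comp0 fg) !compm0 addr0 er.
have mj : mono j.
  apply/monoP=> E x jx.
  have : g \oc x = 0.
    by apply: (ses_mono0 sD); rewrite compA -pDj -compA jx compm0.
  move=> /(ses_lift fg) [y ey].
  have y0 : y = 0.
    by apply: (ses_mono0 sA); rewrite -er -pAj -!compA ey jx compm0.
  by rewrite -ey y0 compm0.
have [Q [q jq]] := mono_ses mj.
have : q \oc iA \oc a = 0.
  by rewrite -compA -jf compA (ses_comp0 jq) comp0m.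
move=> /(ses_desc sA) [u eu].
have : b' \oc pD \oc j = 0.
  by rewrite -compA pDj compA (ses_comp0 sD) comp0m.
move=> /(ses_desc jq) [v ev].
exists Q, S, j, q, u, v; split=> //; apply: sesI.
- by apply: (ses_epi sA); rewrite -compA eu compA ev -compA DA compm0 comp0m.
- move=> P x Pp ux.
  have [x1 ex] := ses_plift sA x Pp.
  have : q \oc (iA \oc x1) = 0 by rewrite compA -eu -compA ex.
  move=> /(ses_lift jq) [y ey].
  have : g \oc y = 0.
    apply: (ses_mono0 sD).
    by rewrite compA -pDj -compA ey compA DA comp0m.
  move=> /(ses_lift fg) [z ez].
  have ex1 : a \oc z = x1.
    rewrite -(comp1m x1) -AA -compA -ey -ez (compA j) jf !compA AA.
    by rewrite comp1m.
  by rewrite -ex -ex1 compA (ses_comp0 sA) comp0m.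
- move=> P y Pp vy.
  have [y1 ey] := ses_plift jq y Pp.
  have : b' \oc (pD \oc y1) = 0 by rewrite compA -ev -compA ey.
  move=> /(ses_lift sD) [z ez]; have [w ew] := ses_plift fg z Pp.
  (* Subtracting an element of B from the lift [y1] removes its PD-component without changing its
     image in Q. *)
  have pDd : pD \oc (y1 - j \oc w) = 0.
    by rewrite compDr compNr (compA pD) pDj -compA ew ez subrr.
  exists (a' \oc (pA \oc (y1 - j \oc w))).
  rewrite compA eu -compA.
  have -> : iA \oc (pA \oc (y1 - j \oc w)) = y1 - j \oc w.
    by rewrite -[RHS]comp1m -e compDl -!compA pDd compm0 addr0.
  by rewrite compDr compNr compA (ses_comp0 jq) comp0m subr0.
- move=> P z Pp; have [x ex] := ses_plift sD z Pp.
  by exists (q \oc (iD \oc x)); rewrite !compA ev -(compA b') DD compm1.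
Qed.

(** The pullback E is the kernel of the difference map A + B -> D; each projection of E inherits the
    kernel of the opposite map. *)
Lemma pullback_ses A B D KA KB (g : hom A D) (h : hom B D) (kA : hom KA A)
    (kB : hom KB B) : ses kA g -> ses kB h ->
  exists E (u : hom KA E) (p : hom E B) (v : hom KB E) (q : hom E A),
    ses u p /\ ses v q.
Proof.
move=> sA sB.
have [S [iA [iB [pA [pB [AA BB AB BA e]]]]]] := abelian_sum Cab A B.
have [E [k kE]] := abelian_ker Cab (g \oc pA - h \oc pB).
have ker X (x : hom X A) (y : hom X B) : g \oc x = h \oc y ->
    exists z : hom X E, pA \oc (k \oc z) = x /\ pB \oc (k \oc z) = y.
  move=> exy.
  have : (g \oc pA - h \oc pB) \oc (iA \oc x + iB \oc y) = 0.
    rewrite compDl compNl !compDr !compA -!(compA _ pA) -!(compA _ pB).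
    by rewrite AA AB BA BB !compm0 !compm1 !comp0m addr0 add0r exy subrr.
  move=> /(kernel_lift kE) [z ez]; exists z; rewrite ez; split.
    by rewrite compDr !compA AA AB comp1m comp0m addr0.
  by rewrite compDr !compA BA BB comp1m comp0m add0r.
have sq X (z : hom X E) : g \oc (pA \oc (k \oc z)) = h \oc (pB \oc (k \oc z)).
  apply/subr0_eq; rewrite -compNl !compA -!compDl compNl.
  by rewrite (kernel_comp0 kE) comp0m.
have ext X (z : hom X E) : pA \oc (k \oc z) = 0 -> pB \oc (k \oc z) = 0 -> z =
  0.
  move=> zA zB; move/monoP: (kernel_mono kE); apply.
  by rewrite -[LHS]comp1m -e compDl -!compA zA zB !compm0 addr0.
have [u [uA uB]] : exists u : hom KA E,
    pA \oc (k \oc u) = kA /\ pB \oc (k \oc u) = 0.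
  by apply: ker; rewrite (ses_comp0 sA) compm0.
have [v [vA vB]] : exists v : hom KB E,
    pA \oc (k \oc v) = 0 /\ pB \oc (k \oc v) = kB.
  by apply: ker; rewrite (ses_comp0 sB) compm0.
exists E, u, (pB \oc k), v, (pA \oc k); split; apply: sesI.
- by rewrite -compA.
- by move=> P x _ ux; apply: (ses_mono0 sA); rewrite -uA -!compA ux !compm0.
- move=> P y _; rewrite -compA => By.
  have : g \oc (pA \oc (k \oc y)) = 0 by rewrite sq By compm0.
  move=> /(ses_lift sA) [x ex]; exists x; apply/subr0_eq/ext.
    by rewrite compA compDr compNr -compA (compA k) (compA pA) uA ex compA
      subrr.
  by rewrite compA compDr compNr -!compA By (compA k) (compA pB) uB comp0m
    subrr.
- move=> P z Pp; have [y /ker [w [_ <-]]] := ses_plift sA (h \oc z) Pp.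
  by exists w; rewrite compA.
- by rewrite -compA.
- by move=> P x _ vx; apply: (ses_mono0 sB); rewrite -vB -!compA vx !compm0.
- move=> P y _; rewrite -compA => Ay.
  have : h \oc (pB \oc (k \oc y)) = 0 by rewrite -sq Ay compm0.
  move=> /(ses_lift sB) [x ex]; exists x; apply/subr0_eq/ext.
    by rewrite compA compDr compNr -!compA Ay (compA k) (compA pA) vA comp0m
      subrr.
  by rewrite compA compDr compNr -compA (compA k) (compA pB) vB ex compA subrr.
- move=> P z Pp; have [y /esym /ker [w [<- _]]] := ses_plift sB (g \oc z) Pp.
  by exists w; rewrite compA.
Qed.

(** * Gorenstein-projective objects *)

(* Ext^1(G, Q) = 0 for all projective Q. *)
Definition perp G : Prop :=
  forall A B (f : hom A B) (g : hom B G), ses f g ->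
  forall Q (a : hom A Q), projective Q -> exists b, b \oc f = a.

(** The sequence splits, and a retraction of [f] extends every map. *)
Lemma perp_projective P : projective P -> perp P.
Proof.
move=> Pp A B f g fg Q a Qp; have [s gs] := ses_plift fg (idm P) Pp.
have : g \oc (idm B - s \oc g) = 0.
  by rewrite compDr compNr compA gs compm1 comp1m subrr.
move=> /(ses_lift fg) [r er]; exists (a \oc r).
have rf : r \oc f = idm A.
  apply: (ses_mono fg).
  by rewrite compA er compDl compNl -compA (ses_comp0 fg) compm0 subr0 comp1m
    compm1.
by rewrite -compA rf compm1.
Qed.

(* The middle term B of another presentation of G is the pushout of A and P
   over K, so extending maps along k suffices. *)
Lemma perp_presentation G K P (k : hom K P) (p : hom P G) :
  projective P -> ses k p ->
  (forall Q (a : hom K Q), projective Q -> exists b, b \oc k = a) -> perp G.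
Proof.
move=> Pp sP H A B f g fg Q a Qp.
have [s gs] := ses_plift fg p Pp.
have : g \oc (s \oc k) = 0 by rewrite compA gs (ses_comp0 sP).
move=> /(ses_lift fg) [t ft]; have [u uk] := H Q (a \oc t) Qp.
have [S [i [j [pi [pj [ii jj ij ji e]]]]]] := abelian_sum Cab A P.
pose q := f \oc pi + s \oc pj.
have eq : epi q.
  apply: epi_projP => X y Xp; have [z ez] := ses_plift sP (g \oc y) Xp.
  have : g \oc (y - s \oc z) = 0.
    by rewrite compDr compNr compA gs ez subrr.
  move=> /(ses_lift fg) [w ew]; exists (i \oc w + j \oc z).
  rewrite compDr !compDl !compA -!(compA _ pi) -!(compA _ pj).
  by rewrite ii ij ji jj !compm1 !compm0 !comp0m addr0 add0r ew subrK.
have [N [n sn]] := epi_ses eq.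
(* The map on A + P given by [a] and [u] kills the kernel of [q], so it descends to B. *)
have : (a \oc pi + u \oc pj) \oc n = 0.
  have en : f \oc (pi \oc n) = - (s \oc (pj \oc n)).
    by rewrite -[RHS]sub0r -(ses_comp0 sn) compDl -!compA addrK.
  have : p \oc (pj \oc n) = 0.
    rewrite -gs -compA -[s \oc _]opprK -en compNr compA (ses_comp0 fg).
    by rewrite comp0m oppr0.
  move=> /(ses_lift sP) [y ey].
  have en' : pi \oc n = - (t \oc y).
    by apply: (ses_mono fg); rewrite en -ey compNr !compA ft.
  by rewrite compDl -!compA en' -ey compNr (compA u) uk -compA addNr.
move=> /(ses_desc sn) [b eb]; exists b.
have -> : f = q \oc i.
  by rewrite compDl -!compA ii ji compm1 compm0 addr0.
by rewrite compA eb compDl -!compA ii ji compm1 compm0 addr0.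
Qed.

(** For an extension N of B by M, the preimage N' of A in N is an extension of A by M, and N is one
    of D by N'. A map on M is extended first to N', then to N. *)
Lemma perp_ses A B D (f : hom A B) (g : hom B D) :
  ses f g -> perp A -> perp D -> perp B.
Proof.
move=> fg pA pD M N m n mn Q a Qp.
have egn : epi (g \oc n).
  apply: epi_projP => P z Pp; have [y <-] := ses_plift fg z Pp.
  by have [x <-] := ses_plift mn y Pp; exists x; rewrite compA.
have [N' [k sk]] := epi_ses egn.
have : g \oc n \oc m = 0 by rewrite -compA (ses_comp0 mn) compm0.
move=> /(ses_lift sk) [m' em].
have : g \oc (n \oc k) = 0 by rewrite compA (ses_comp0 sk).
move=> /(ses_lift fg) [n' en].
have mn' : ses m' n'.
  apply: sesI.
  - by apply: (ses_mono fg); rewrite compA en -compA em (ses_comp0 mn) compm0.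
  - by move=> P x _ mx; apply: (ses_mono0 mn); rewrite -em -compA mx compm0.
  - move=> P y _ ny.
    have : n \oc (k \oc y) = 0 by rewrite compA -en -compA ny compm0.
    move=> /(ses_lift mn) [x ex]; exists x.
    by apply: (ses_mono sk); rewrite compA em.
  - move=> P z Pp; have [y ey] := ses_plift mn (f \oc z) Pp.
    have : g \oc n \oc y = 0 by rewrite -compA ey compA (ses_comp0 fg) comp0m.
    move=> /(ses_lift sk) [w ew]; exists w; apply: (ses_mono fg).
    by rewrite compA en -compA ew.
have [b1 e1] := pA _ _ _ _ mn' Q a Qp; have [b e2] := pD _ _ _ _ sk Q b1 Qp.
by exists b; rewrite -em compA e2.
Qed.

(** Adding B to an extension of A by M gives an extension of G by M; extend the map there and
    restrict it. *)
Lemma perp_summand A B G : is_direct_sum2 A B G -> perp G -> perp A.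
Proof.
move=> [iA [iB [pA [pB [AA BB AB BA e]]]]] pG M N m n mn Q a Qp.
have [S [j [j' [q [q' [jj jj' qj' q'j e']]]]]] := abelian_sum Cab N B.
have sS : ses (j \oc m) (iA \oc n \oc q + iB \oc q').
  apply: sesI.
  - rewrite compDl -!compA (compA q j) jj comp1m (compA q') q'j comp0m compm0.
    by rewrite (ses_comp0 mn) compm0 addr0.
  - move=> P x _ x0; apply: (ses_mono0 mn).
    by rewrite -[LHS]comp1m -jj -!compA (compA j) x0 compm0.
  - move=> P y _ y0.
    have : n \oc (q \oc y) = 0.
      transitivity (pA \oc 0 : hom P A); last by rewrite compm0.
      by rewrite -y0 compDl compDr !compA AA AB comp1m !comp0m addr0.
    move=> /(ses_lift mn) [x ex]; exists x.
    have q'y : q' \oc y = 0.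
      transitivity (pB \oc 0 : hom P B); last by rewrite compm0.
      by rewrite -y0 compDl compDr !compA BA BB comp1m !comp0m add0r.
    rewrite -compA ex -[RHS]comp1m -e' compDl -!compA q'y.
    by rewrite compm0 addr0.
  - move=> P z Pp; have [x ex] := ses_plift mn (pA \oc z) Pp.
    exists (j \oc x + j' \oc (pB \oc z)).
    rewrite compDl !compDr -!compA !(compA q) !(compA q').
    rewrite jj qj' q'j jj' !comp0m !comp1m !compm0 addr0 add0r.
    by rewrite ex !compA -compDl e comp1m.
have [b eb] := pG _ _ _ _ sS Q a Qp.
by exists (b \oc j); rewrite -compA.
Qed.
Lemma exact_epi_cokernel A B D (f : hom A B) (g : hom B D) :
  exact f g -> epi g -> is_cokernel f g.
Proof.
move=> /exactP [gf H] eg; apply: cokernelI => // E h hf.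
have [N [n sn]] := epi_ses eg; apply: (ses_desc sn).
have [K [P [k [e [Pp se]]]]] := proj_ses N.
apply: (ses_epi se).
have gne : g \oc (n \oc e) = 0 by rewrite compA (ses_comp0 sn) comp0m.
have [x ex] := H _ _ Pp gne.
by rewrite comp0m -compA -ex compA hf comp0m.
Qed.

(* Being Gorenstein-projective is the largest good property, so that closure
   properties can be proved by coinduction. *)
Definition good (Z : C -> Prop) : Prop := forall G, Z G ->
  [/\ perp G,
      exists P G' (f : hom G P) (g : hom P G'),
        [/\ projective P, Z G' & ses f g]
    & exists K P (f : hom K P) (g : hom P G),
        [/\ projective P, Z K & ses f g]].

(** Cosyzygies to the right and syzygies to the left give short exact sequences indexed by the
    integers; splicing them yields a totally acyclic complex. *)
Lemma good_gproj (Z : C -> Prop) G : good Z -> Z G -> gproj G.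
Proof.
move=> gZ ZG.
pose R A B := exists P (f : hom A P) (g : hom P B), projective P /\ ses f g.
have [||H [H1 ZH RH]] := int_sequence (Z := Z) (R := R) (x0 := G) _ _ ZG.
- move=> A /gZ [_ [P [B [f [g [Pp ZB fg]]]]] _]; exists B => //.
  by exists P, f, g.
- move=> A /gZ [_ _ [B [P [f [g [Pp ZB fg]]]]]]; exists B => //.
  by exists P, f, g.
have [P HP] := choice RH.
pose m i := sval (cid (HP i)); pose c i := sval (cid (svalP (cid (HP i)))).
have [Pp S] : (forall i, projective (P i)) /\ (forall i, ses (m i) (c i)).
  by split=> i; have [] := svalP (cid (svalP (cid (HP i)))).
pose d i := m (i + 1) \oc c i.
have d2 i : d (i + 1) \oc d i = 0.
  by rewrite /d !compA -(compA _ (c (i + 1))) (ses_comp0 (S (i + 1))) compm0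
    comp0m.
case: _ / H1.
exists (Complex d2), (c 0); split.
  split=> // [i | Q Qp i u].
    apply/exactP; split=> // X y Xp; rewrite /= /d -compA.
    move=> /(ses_mono0 (S (i + 1 + 1))) /(ses_lift (S (i + 1))) [x ex].
    have [z ez] := ses_plift (S i) x Xp.
    by exists z; rewrite -compA ez.
  split=> [ud | [v <-]]; last by rewrite -compA d2 compm0.
  have um : u \oc m (i + 1) = 0.
    by apply: (ses_epi (S i)); rewrite comp0m -compA.
  have [w ew] := ses_desc (S (i + 1)) um.
  (* The map [w] lives on term i + 2, and the next cosyzygy, term i + 3, controls its extension to
     the projective in degree i + 2. *)
  have [perpG _ _] := gZ _ (ZH (i + 1 + 1 + 1)).
  have [v ev] := perpG _ _ _ _ (S (i + 1 + 1)) Q w Qp.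
  by exists v; rewrite /= /d compA ev.
have S0 := ses_cokernel (S 0).
apply: cokernelI; first exact: cokernel_epi S0.
  by rewrite /= /d compA (proj1 S0) comp0m.
move=> D h hd; apply: (cokernel_desc S0); apply: (ses_epi (S (-1))).
by rewrite comp0m -compA.
Qed.

(** The cokernels of all differentials of one totally acyclic complex form a good class:
    neighbouring cokernels are the syzygy and the cosyzygy. By [good_gproj] its members are
    Gorenstein-projective. *)
Lemma gproj_good : good (@gproj C).
Proof.
move=> G [P [c [[Pp Pex Phom] cP]]].
pose Z X := exists i (c : hom (P (i + 1)) X), is_cokernel (diff P i) c.
suff gZ : good Z.
  have ZG : Z G by exists (- 1), c.
  have [pG [Q [G' [f [g [Qp /(good_gproj gZ) ? ?]]]]]] := gZ G ZG.
  move=> [K [Q' [f' [g' [? /(good_gproj gZ) ? ?]]]]].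
  by split=> //; [exists Q, G', f, g | exists K, Q', f', g'].
move=> {c cP}X [i [c cP]].
(* Writing the index as a successor makes the preceding differential [diff P j] composable without
   casts. *)
have [j ej] : exists j, i = j + 1 by exists (i - 1); rewrite subrK.
move: c cP; rewrite {i}ej => c cP.
have ec := cokernel_epi cP.
have [_ ex1] := (exactP _ _).1 (Pex j).
have [_ ex2] := (exactP _ _).1 (Pex (j + 1)).
have [m em] := cokernel_desc cP (diff2 P (j + 1)).
have mm : mono m.
  apply: mono_projP => Q x Qp mx; have [y ey] := Qp _ _ c x ec.
  have : diff P (j + 1 + 1) \oc y = 0 by rewrite -em -compA ey.
  by move=> /(ex2 _ _ Qp) [z ez]; rewrite -ey -ez compA (proj1 cP) comp0m.
have [X' [q sq]] := mono_ses mm; have [K [k sk]] := epi_ses ec.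
have [b eb] := ses_lift sk (proj1 cP).
have eb' : epi b.
  apply: epi_projP => Q y Qp.
  have : diff P (j + 1 + 1) \oc (k \oc y) = 0.
    by rewrite -em -compA (compA c) (ses_comp0 sk) comp0m compm0.
  move=> /(ex2 _ _ Qp) [z ez]; exists z; apply: (ses_mono sk).
  by rewrite compA eb.
have bP : is_cokernel (diff P j) b.
  apply: exact_epi_cokernel => //; apply/exactP; split=> [|Q y Qp y0].
    by apply: (ses_mono sk); rewrite compA eb diff2 compm0.
  by apply: ex1 => //; rewrite -eb -compA y0 compm0.
split.
(* A map [a] on the syzygy gives the cocycle a b; acyclicity of Hom into Q writes it as v k b, and
   [b] is epi. *)
- apply: (perp_presentation (Pp _) sk) => Q a Qp.
  have : a \oc b \oc diff P j = 0 by rewrite -compA (proj1 bP) compm0.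
  move=> /(Phom Q Qp) [v ev]; exists v; apply: eb'.
  by rewrite -compA eb.
- exists (P (j + 1 + 1 + 1)), X', m, q; split=> //.
  exists (j + 1 + 1), q; apply: cokernelI; first by case: sq.
    by rewrite -em compA (ses_comp0 sq) comp0m.
  move=> D h; rewrite -em => hm; apply: (ses_desc sq); apply: ec.
  by rewrite comp0m -compA.
- by exists K, (P (j + 1 + 1)), k, c; split=> //; exists j, b.
Qed.

(** * Closure properties of the Gorenstein-projective objects *)

Lemma gproj_projective P : projective P -> gproj P.
Proof.
(* Coinduction on the class of projectives, using P = P -> 0 and 0 -> P = P. *)
move=> Pp; apply: (@good_gproj (@projective C)) => // {Pp}P Pp.
have [Z Z0] := abelian_zero Cab; have Zp := projective_zero Z0.
split; first exact: perp_projective.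
- exists P, Z, (idm P), 0; split=> //; apply: sesI; first by rewrite comp0m.
  + by move=> Q x _; rewrite comp1m.
  + by move=> Q y _ _; exists y; rewrite comp1m.
  + by move=> Q z _; exists 0; rewrite compm0 (zero_codom z).
- exists Z, P, 0, (idm P); split=> //; apply: sesI; first by rewrite compm0.
  + by move=> Q x _ _; rewrite (zero_codom x).
  + by move=> Q y _; rewrite comp1m => ->; exists 0; rewrite compm0.
  + by move=> Q z _; exists z; rewrite comp1m.
Qed.

(** Coinduction on extensions of Gorenstein-projectives: the horseshoes make syzygies and cosyzygies
    such extensions again, and vanishing of Ext^1 for [D] supplies the map [r] of [cohorseshoe]. *)
Lemma gproj_ext A B D (f : hom A B) (g : hom B D) :
  ses f g -> gproj A -> gproj D -> gproj B.
Proof.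
move=> fg gA gD.
pose Z X := exists A D (f : hom A X) (g : hom X D),
  [/\ ses f g, gproj A & gproj D].
apply: (@good_gproj Z); last by exists A, D, f, g.
move=> {A B D f g fg gA gD}B [A [D [f [g [fg gA gD]]]]].
have [pA [PA [A' [a [a' [PAp gA' sA]]]]]] := gproj_good gA.
move=> [KA [QA [k [e [QAp gKA sKA]]]]].
have [pD [PD [D' [b [b' [PDp gD' sD]]]]]] := gproj_good gD.
move=> [KD [QD [k' [e' [QDp gKD sKD]]]]].
split; first exact: perp_ses fg pA pD.
- have [r er] := pD _ _ _ _ fg PA a PAp.
  have [Q [S [j [q [u [v [PS jq uv]]]]]]] := cohorseshoe fg sA sD er.
  exists S, Q, j, q; split=> //; first exact: projective_sum2 PS.
  by exists A', D', u, v.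
- have [K [S [j [q [u [v [PS jq uv]]]]]]] := horseshoe fg sKA sKD QDp.
  exists K, S, j, q; split=> //; first exact: projective_sum2 PS.
  by exists KA, KD, u, v.
Qed.

(* If A + B = G and 0 -> G -> P -> G' -> 0, the cokernel Q of A -> P satisfies
   0 -> G -> Q + A -> G' -> 0, so it is again a summand of a
   Gorenstein-projective object; dually for syzygies. *)
Lemma gproj_summand A G : direct_summand A G -> gproj G -> gproj A.
Proof.
move=> [B AB] gG.
pose Z (X : C) := exists Y G, is_direct_sum2 X Y G /\ gproj G.
apply: (@good_gproj Z); last by exists B, G.
move=> {A B G AB gG}A [B [G [HG gG]]].
have [pG [P [G' [m [c [Pp gG' mc]]]]]] := gproj_good gG.
move=> [K [P' [k [e [P'p gK ke]]]]].
split; first exact: perp_summand HG pG.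
- have [iA [iB [pA [pB [AA BB AB BA E]]]]] := HG.
  have mA : mono (m \oc iA).
    apply/monoP=> X x; rewrite -compA => /(ses_mono0 mc) ix.
    by rewrite -(comp1m x) -AA -compA ix compm0.
  have [Q [q sq]] := mono_ses mA.
  exists P, Q, (m \oc iA), q; split=> //.
  have [S HS] := abelian_sum Cab Q A; exists A, S; split=> //.
  have [jQ [jA [rQ [rA [QQ AA' QA AQ E']]]]] := HS.
  have : c \oc (m \oc iA) = 0 by rewrite compA (ses_comp0 mc) comp0m.
  move=> /(ses_desc sq) [w ew].
  have qmA : q \oc m \oc iA = 0 by rewrite -compA (ses_comp0 sq).
  (* G maps to Q by q m and to A by the projection. *)
  apply: (@gproj_ext G S G' (jQ \oc (q \oc m) + jA \oc pA) (w \oc rQ)) => //.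
  apply: sesI.
  + rewrite compDr -!compA (compA rQ) QQ comp1m (compA rQ) QA comp0m !compm0
    addr0.
    by rewrite compA ew (ses_comp0 mc).
  + move=> X x _ x0.
    have px : pA \oc x = 0.
      transitivity (rA \oc 0 : hom X A); last by rewrite compm0.
      by rewrite -x0 !compDl compDr !compA AQ AA' comp1m !comp0m add0r.
    have : q \oc (m \oc x) = 0.
      transitivity (rQ \oc 0 : hom X Q); last by rewrite compm0.
      by rewrite -x0 !compDl compDr !compA QQ QA comp1m !comp0m addr0.
    move=> /(ses_lift sq) [t]; rewrite -compA => /(ses_mono mc) et.
    have t0 : t = 0 by rewrite -(comp1m t) -AA -compA et.
    by rewrite -et t0 compm0.
  + move=> X y Xp y0; have [y1 ey] := ses_plift sq (rQ \oc y) Xp.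
    have : c \oc y1 = 0 by rewrite -ew -compA ey compA.
    move=> /(ses_lift mc) [z ez].
    (* The correction lies in A, which q m kills, so it adjusts only the A-component. *)
    exists (z + iA \oc (rA \oc y - pA \oc z)).
    set x := z + _.
    have pAx : pA \oc x = rA \oc y.
      by rewrite compDr compA AA comp1m addrC subrK.
    have qmx : q \oc (m \oc x) = rQ \oc y.
      rewrite compDr compDr ez ey (compA m) (compA q) (ses_comp0 sq) comp0m.
      by rewrite addr0.
    by rewrite -[RHS]comp1m -E' !compDl -!compA pAx qmx.
  + move=> X z Xp; have [x ex] := ses_plift mc z Xp.
    exists (jQ \oc (q \oc x)).
    by rewrite -compA (compA rQ) QQ comp1m compA ew.
- have [iA [iB [pA [pB [AA BB AB BA E]]]]] := HG.
  have eA : epi (pA \oc e).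
    apply: epi_projP => X y Xp; have [x ex] := ses_plift ke (iA \oc y) Xp.
    by exists x; rewrite -compA ex compA AA comp1m.
  have [L [l sl]] := epi_ses eA.
  exists L, P', l, (pA \oc e); split=> //.
  have [S HS] := abelian_sum Cab L A; exists A, S; split=> //.
  have [jL [jA [rL [rA [LL AA' LA AL E']]]]] := HS.
  have : pA \oc e \oc k = 0 by rewrite -compA (ses_comp0 ke) compm0.
  move=> /(ses_lift sl) [w ew].
  (* K -> L + A -> G is exact, so the syzygy L is a summand of an extension of G by K. *)
  apply: (@gproj_ext K S G (jL \oc w) (e \oc l \oc rL + iA \oc rA)) => //.
  have pel : pA \oc (e \oc l) = 0 by rewrite compA (ses_comp0 sl).
  apply: sesI.
  + rewrite compDl -!compA (compA rL) (compA rA) LL AL comp1m comp0m compm0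
    addr0.
    by rewrite ew (ses_comp0 ke).
  + move=> X x _ x0; apply: (ses_mono0 ke).
    by rewrite -ew -compA -[w \oc x]comp1m -LL -compA (compA jL) x0 !compm0.
  + move=> X y Xp y0.
    have ry : rA \oc y = 0.
      transitivity (pA \oc 0 : hom X A); last by rewrite compm0.
      by rewrite -y0 compDl compDr !compA -(compA pA e) pel AA comp1m !comp0m
        add0r.
    have : e \oc (l \oc (rL \oc y)) = 0.
      by rewrite -[RHS]y0 compDl -!compA ry compm0 addr0.
    move=> /(ses_lift ke) [x ex]; exists x.
    have wx : w \oc x = rL \oc y by apply: (ses_mono sl); rewrite compA ew.
    by rewrite -compA wx -[RHS]comp1m -E' compDl -!compA ry compm0 addr0.
  + move=> X z Xp.
    have [p ep] := ses_plift ke (z - iA \oc (pA \oc z)) Xp.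
    have : pA \oc e \oc p = 0.
      by rewrite -compA ep compDr compNr !compA AA comp1m subrr.
    move=> /(ses_lift sl) [t et].
    exists (jL \oc t + jA \oc (pA \oc z)).
    rewrite compDl !compDr -!compA !(compA rL) !(compA rA) LL LA AL AA'.
    by rewrite !comp0m !comp1m !compm0 addr0 add0r et ep subrK.
Qed.

(** Pull [g] back along a projective P -> D with Gorenstein-projective kernel K. The pullback E is
    an extension of B by K, and its projection to P splits with kernel A. *)
Lemma gproj_ker A B D (f : hom A B) (g : hom B D) :
  ses f g -> gproj B -> gproj D -> gproj A.
Proof.
move=> fg gB /gproj_good [_ _ [K [P [k [c [Pp gK kc]]]]]].
have [E [u [p [v [q [up vq]]]]]] := pullback_ses kc fg.
have gE : gproj E by exact: gproj_ext up gK gB.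
apply: gproj_summand gE; have [s es] := ses_plift vq (idm P) Pp.
have : q \oc (idm E - s \oc q) = 0.
  by rewrite compDr compNr compA es compm1 comp1m subrr.
move=> /(ses_lift vq) [r er].
apply: (retract_summand (s := v) (p := r)); apply: (ses_mono vq).
by rewrite compA er compDl compNl -compA (ses_comp0 vq) compm0 subr0 comp1m
  compm1.
Qed.

Lemma gproj_resolving : resolving (@gproj C).
Proof.
split; first exact: gproj_projective.
- by move=> A B D f g /ses_short_exact; apply: gproj_ext.
- by move=> A B D f g /ses_short_exact; apply: gproj_ker.
- exact: gproj_summand.
Qed.
(** * Resolution dimension with respect to a resolving subcategory *)

Section Resolving.
Variable X : C -> Prop.
Hypothesis RX : resolving X.

(** Peels off one syzygy at a time; in contrast to [has_resolution], it bounds the length from above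
    ([resdS]). *)
Fixpoint resd (n : nat) A : Prop :=
  if n is n'.+1 then
    exists K Y (k : hom K Y) (e : hom Y A), [/\ X Y, ses k e & resd n' K]
  else X A.

Lemma resolving_retract A B (s : hom A B) (p : hom B A) :
  p \oc s = idm A -> X B -> X A.
Proof. by move/retract_summand; apply: resolving_summand. Qed.

Lemma resolving_sum2 A B S : is_direct_sum2 A B S -> X A -> X B -> X S.
Proof.
move=> [iA [iB [pA [pB AB]]]]; apply: resolving_ext RX _ _ _ _ _ _.
by apply/ses_short_exact; apply: sum2_ses AB.
Qed.

Lemma resolving_zero Z : zero_object Z -> X Z.
Proof. by move/projective_zero; apply: resolving_proj. Qed.

Lemma resdS n A : resd n A -> resd n.+1 A.
Proof.
elim: n A => [|n IH] A /=.
  move=> XA; have [Z Z0] := abelian_zero Cab.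
  exists Z, A, 0, (idm A); split=> //; last exact: resolving_zero.
  apply: sesI => [|Q x _ _|Q y _|Q z _]; first by rewrite compm0.
  - by rewrite (zero_codom x).
  - by rewrite comp1m => ->; exists 0; rewrite compm0.
  - by exists z; rewrite comp1m.
move=> [K [Y [k [e [XY ke /IH rK]]]]].
by exists K, Y, k, e.
Qed.

Lemma resd_leq m n A : (m <= n)%N -> resd m A -> resd n A.
Proof.
move=> /subnK <-; elim: (n - m)%N => // k IH /IH.
by rewrite addSn; apply: resdS.
Qed.

(** Apply the horseshoe to a projective presentation of [D], whose syzygy is again in [X], and
    induct on the kernels. *)
Lemma resd_ext n A B D (f : hom A B) (g : hom B D) :
  ses f g -> resd n A -> X D -> resd n B.
Proof.
elim: n A B D f g => [|n IH] A B D f g fg.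
  by apply: resolving_ext RX _ _ _ _ _ _; apply/ses_short_exact; apply: fg.
move=> [L [Y [l [y [XY ly rL]]]]] XD.
have [M [P [m [e [Pp me]]]]] := proj_ses D.
have XP := resolving_proj RX Pp.
have [K [S [k [q [u [v [YS kq uv]]]]]]] := horseshoe fg ly me Pp.
exists K, S, k, q; split=> //; first exact: resolving_sum2 YS _ _.
apply: (IH _ _ _ u v uv rL).
by apply: (resolving_ker RX) XP XD; apply/ses_short_exact; apply: me.
Qed.

(** If Y -> B starts the resolution, the preimage of A in Y is the kernel of Y -> D, hence in [X],
    and it covers A with the same syzygy. *)
Lemma resd_ker n A B D (f : hom A B) (g : hom B D) :
  ses f g -> resd n B -> X D -> resd n A.
Proof.
case: n => [|n] fg.
  by apply: resolving_ker RX _ _ _ _ _ _; apply/ses_short_exact; apply: fg.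
move=> [L [Y [l [y [XY ly rL]]]]] XD.
have egy : epi (g \oc y).
  apply: epi_projP => P z Pp; have [w <-] := ses_plift fg z Pp.
  by have [v <-] := ses_plift ly w Pp; exists v; rewrite compA.
have [K [k sk]] := epi_ses egy.
have XK : X K by apply: (resolving_ker RX) XY XD; apply/ses_short_exact/sk.
have : g \oc y \oc l = 0 by rewrite -compA (ses_comp0 ly) compm0.
move=> /(ses_lift sk) [l' el].
have : g \oc (y \oc k) = 0 by rewrite compA (ses_comp0 sk).
move=> /(ses_lift fg) [y' ey].
exists L, K, l', y'; split=> //; apply: sesI.
- by apply: (ses_mono fg); rewrite compA ey -compA el (ses_comp0 ly) compm0.
- by move=> P x _ x0; apply: (ses_mono0 ly); rewrite -el -compA x0 compm0.
- move=> P x _ x0.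
  have : y \oc (k \oc x) = 0 by rewrite compA -ey -compA x0 compm0.
  move=> /(ses_lift ly) [t et]; exists t; apply: (ses_mono sk).
  by rewrite compA el.
- move=> P z Pp; have [w ew] := ses_plift ly (f \oc z) Pp.
  have : g \oc y \oc w = 0 by rewrite -compA ew compA (ses_comp0 fg) comp0m.
  move=> /(ses_lift sk) [t et]; exists t; apply: (ses_mono fg).
  by rewrite compA ey -compA et.
Qed.

(* Compare the two syzygies K and K' of A through the pullback E of the two
   presentations, which is an extension of objects of X by either of them. *)
Lemma resd_syzygy n A K Y (k : hom K Y) (e : hom Y A) :
  ses k e -> X Y -> resd n.+1 A -> resd n K.
Proof.
move=> ke XY [K' [Y' [k' [e' [XY' ke' rK']]]]].
have [E [u [p [v [q [up vq]]]]]] := pullback_ses ke' ke.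
by apply: (resd_ker vq) XY'; apply: (resd_ext up).
Qed.

Lemma has_resolution_resd n A : has_resolution X A n -> resd n A.
Proof.
elim: n A => [|n IH] A [F [d [e [XF ZF ee /exactP [ed Hd] exd]]]] /=.
  have [K [k ke]] := epi_ses ee.
  (* In length 0 the term in degree 1 is zero, so the augmentation is an isomorphism. *)
  have K0 : zero_object K.
    apply: zero_object_idm; have [L [P [l [p [Pp lp]]]]] := proj_ses K.
    apply: (ses_epi lp); rewrite comp1m comp0m; apply: (ses_mono0 ke).
    have ekp : e \oc (k \oc p) = 0 by rewrite compA (ses_comp0 ke) comp0m.
    have [x <-] := Hd _ _ Pp ekp.
    by rewrite (zero_codom x) ?compm0 //; apply: ZF.
  have [h [he eh]] := iso_ses K0 ke.
  by apply: (resolving_retract eh); apply: XF.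
have [K [k ke]] := epi_ses ee; have [e' ee'] := ses_lift ke ed.
exists K, (F 0%N), k, e; split=> //; first exact: XF.
apply: IH; exists (fun i => F i.+1), (fun i => d i.+1), e'; split=> //.
- by move=> i lein; apply: XF.
- by move=> i ltni; apply: ZF.
- apply: epi_projP => P y Pp.
  have eky : e \oc (k \oc y) = 0 by rewrite compA (ses_comp0 ke) comp0m.
  have [x ex] := Hd _ _ Pp eky; exists x; apply: (ses_mono ke).
  by rewrite compA ee'.
- have /exactP [dd Hd1] := exd 0%N.
  apply/exactP; split=> [|P y Pp y0].
    by apply: (ses_mono ke); rewrite compA ee' dd compm0.
  by apply: Hd1 => //; rewrite -ee' -compA y0 compm0.
Qed.

Lemma finite_resdim_resd :
  finite_resdim X -> exists n, forall A, resd n A.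
Proof.
move=> [n H]; exists n => A; have [m lemn /has_resolution_resd] := H A.
exact: resd_leq.
Qed.

(* Every Gorenstein-projective object is an n-th syzygy for every n. *)
Lemma gproj_sub_resolving :
  finite_resdim X -> forall G, gproj G -> X G.
Proof.
move=> /finite_resdim_resd [n H].
have {H} : forall G, gproj G -> resd n G by move=> G _; apply: H.
elim: n => // n IH H; apply: IH => G gG.
have [_ [P [G' [f [g [Pp gG' fg]]]]] _] := gproj_good gG.
by apply: (resd_syzygy fg); [exact: resolving_proj | exact: H].
Qed.

End Resolving.
(** * Objects of add T and modules over End(T)^op *)
Implicit Types T E : C.

Definition T_exact T A B D (f : hom A B) (g : hom B D) : Prop :=
  forall y : hom T B, g \oc y = 0 <-> exists x, f \oc x = y.

Definition T_surj T A B (f : hom A B) : Prop :=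
  forall y : hom T B, exists x, f \oc x = y.

Lemma direct_sum_mono n T S (inj : 'I_n -> hom T S)
    (prj : 'I_n -> hom S T) E (x : hom E S) :
  \sum_i inj i \oc prj i = idm S -> (forall i, prj i \oc x = 0) -> x = 0.
Proof.
move=> e x0; rewrite -[LHS]comp1m -e comp_suml big1 // => i _.
by rewrite -compA x0 compm0.
Qed.

Lemma direct_sum_prj n T S (inj : 'I_n -> hom T S)
    (prj : 'I_n -> hom S T) E (x : 'I_n -> hom E T) i :
  (forall i, prj i \oc inj i = idm T) ->
  (forall i j, i != j -> prj i \oc inj j = 0) ->
  prj i \oc (\sum_j inj j \oc x j) = x i.
Proof.
move=> pii pij; rewrite comp_sumr (bigD1 i) //= compA pii comp1m big1 ?addr0 //.
by move=> j nji; rewrite compA pij ?comp0m // eq_sym.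
Qed.

Lemma const_direct_sum (X : C -> Prop) T n : resolving X -> X T ->
  exists2 S, X S & is_direct_sum (fun _ : 'I_n => T) S.
Proof.
move=> RX XT; elim: n => [|n [S XS [inj [prj [pii pij e]]]]].
  have [Z Z0] := abelian_zero Cab; exists Z; first exact: resolving_zero Z0.
  exists (fun _ => 0), (fun _ => 0); split=> [i|i|]; [by have := ltn_ord i |
    by have := ltn_ord i |].
  by rewrite big_ord0 (zero_dom (idm Z)).
have [S' HS] := abelian_sum Cab T S.
exists S'; first exact: resolving_sum2 HS XT XS.
have [i [j [p [q [ii jj pj qi E]]]]] := HS.
(* Index 0 is the new copy of T; the others pass through the sum already built. *)
exists (fun k => if unlift ord0 k is Some l then j \oc inj l else i).
exists (fun k => if unlift ord0 k is Some l then prj l \oc q else p).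
split.
- move=> k; case: unliftP => [l _|_] //.
  by rewrite -compA (compA q) jj comp1m.
- move=> k k'; case: unliftP => [l ->|->]; case: unliftP => [l' ->|->] //.
  + rewrite (inj_eq lift_inj) => /pij.
    by rewrite -compA (compA q) jj comp1m.
  + by rewrite -compA qi compm0.
  + by rewrite compA pj comp0m.
- rewrite big_ord_recl unlift_none -[RHS]E; congr (_ + _).
  rewrite -[in RHS](comp1m q) -e comp_suml comp_sumr; apply: eq_bigr => k _.
  by rewrite liftK !compA.
Qed.

Lemma add_coordinates T A : add_closure T A ->
  exists n (s : 'I_n -> hom A T) (p : 'I_n -> hom T A), coordinates s p.
Proof.
move=> [n [S [[inj [prj [_ _ e]]] [B [s [_ [p [_ [ps _ _ _ _]]]]]]]]].
exists n, (fun i => prj i \oc s), (fun i => p \oc inj i).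
rewrite /coordinates -ps -[in RHS](comp1m s) -e comp_suml comp_sumr.
by apply: eq_bigr => i _; rewrite !compA.
Qed.

Lemma coordinates_retract n T A S (inj : 'I_n -> hom T S)
    (prj : 'I_n -> hom S T) (s : 'I_n -> hom A T) (p : 'I_n -> hom T A) :
  coordinates s p ->
  (forall i, prj i \oc inj i = idm T) ->
  (forall i j, i != j -> prj i \oc inj j = 0) -> direct_summand A S.
Proof.
move=> sp pii pij.
apply: (@retract_summand _ _ (\sum_i inj i \oc s i) (\sum_i p i \oc prj i)).
rewrite comp_suml -[RHS]sp; apply: eq_bigr => i _.
by rewrite -compA direct_sum_prj.
Qed.

Lemma coordinates_add (X : C -> Prop) n T A (s : 'I_n -> hom A T)
    (p : 'I_n -> hom T A) :
  resolving X -> X T -> coordinates s p -> add_closure T A /\ X A.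
Proof.
move=> RX XT sp; have [S XS HS] := const_direct_sum n RX XT.
have AS : direct_summand A S.
  by have [inj [prj [pii pij _]]] := HS; exact: coordinates_retract sp pii pij.
by split; [exists n, S | exact: resolving_summand AS XS].
Qed.

Lemma add_sub (X : C -> Prop) T A :
  resolving X -> X T -> add_closure T A -> X A.
Proof.
by move=> RX XT /add_coordinates [n [s [p /(coordinates_add RX XT) []]]].
Qed.

Lemma finite_family_retracts (X : C -> Prop) n (F : 'I_n -> C) :
  resolving X -> (forall i, X (F i)) ->
  exists2 T, X T & forall i, direct_summand (F i) T.
Proof.
move=> RX; elim: n F => [|n IH] F XF.
  have [Z Z0] := abelian_zero Cab.
  by exists Z => [|i]; [|by have := ltn_ord i]; exact: resolving_zero Z0.
have [T XT HT] := IH (fun i => F (lift ord0 i)) (fun i => XF _).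
have [S HS] := abelian_sum Cab (F ord0) T.
exists S; first exact: resolving_sum2 HS (XF _) XT.
have [i [j [p [q [ii jj pj qi E]]]]] := HS => k.
case: (unliftP ord0 k) => [l ->|->]; last by exists T.
have [B [s [_ [r [_ [rs _ _ _ _]]]]]] := HT l.
apply: (@retract_summand _ _ (j \oc s) (r \oc q)).
by rewrite -compA (compA q) jj comp1m.
Qed.

(** T is a direct sum of representatives of the indecomposables. Every object of [X] is a finite sum
    of retracts of T, and these retractions form coordinates. *)
Lemma finite_rep_type_add (X : C -> Prop) : resolving X -> finite_rep_type X ->
  exists T, forall A, X A <-> add_closure T A.
Proof.
move=> RX [_ KS [n [F HF]]].
have [Z Z0] := abelian_zero Cab.
(* The listed objects may lie outside [X]; those are replaced by zero. *)
have /choice [F' HF'] i : exists Y, X Y /\ (X (F i) -> Y = F i).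
  have [XFi | nX] := pselect (X (F i)); first by exists (F i).
  by exists Z; split=> //; exact: resolving_zero Z0.
have XF' i : X (F' i) by case: (HF' i).
have [T XT HT] := finite_family_retracts RX XF'.
have ind A : indecomposable X A -> direct_summand A T.
  move=> iA; have [i [f [g [gf fg]]]] := HF A iA; have XA : X A by case: iA.
  have XFi : X (F i) by exact: resolving_retract fg XA.
  have := HT i; have [_ ->//] := HF' i.
  move=> [B [s [_ [p [_ [ps _ _ _ _]]]]]].
  apply: (@retract_summand _ _ (s \oc f) (g \oc p)).
  by rewrite -compA (compA p) ps comp1m.
exists T => A; split=> [/KS [m [G [iG [inj [prj [pii pij e]]]]]] | ].
  have H i : exists sp : hom (G i) T * hom T (G i), sp.2 \oc sp.1 = idm (G i).
    have [/ind [B [s [_ [p [_ [ps _ _ _ _]]]]]] _] := iG i.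
    by exists (s, p).
  pose s i := sval (cid (H i)).
  have sP i : (s i).2 \oc (s i).1 = idm (G i) by exact: svalP (cid (H i)).
  have sp : coordinates (fun i => (s i).1 \oc prj i) (fun i => inj i \oc (s
    i).2).
    rewrite /coordinates -[RHS]e; apply: eq_bigr => i _.
    by rewrite -compA (compA (s i).2) sP comp1m.
  by case: (coordinates_add RX XT sp).
exact: add_sub.
Qed.

(** * Resolving subcategories add T with approximations *)

Section Add.
Variables (T : C) (X : C -> Prop).
Hypotheses (RX : resolving X) (addX : forall A, X A <-> add_closure T A)
  (gen : forall A, hom_generated T A).

Lemma X_coordinates A : X A ->
  exists n (s : 'I_n -> hom A T) (p : 'I_n -> hom T A), coordinates s p.
Proof. by move/addX/add_coordinates. Qed.

Lemma X_generator : X T.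
Proof.
have [Z Z0] := abelian_zero Cab.
apply/addX; exists 1%N, T; split.
  exists (fun _ => idm T), (fun _ => idm T).
  by split=> [i|i j|]; rewrite ?ord1 ?big_ord1 ?compm1.
by exists Z; exists (idm T), 0, (idm T), 0; split;
  rewrite ?compm1 ?comp0m ?compm0 ?addr0 // (zero_dom (idm Z)).
Qed.

Lemma power n : exists2 S, X S & is_direct_sum (fun _ : 'I_n => T) S.
Proof. exact: const_direct_sum RX X_generator. Qed.

(** Lift the composites of [y] with the coordinates [p i], then recombine them with the [s i]. *)
Lemma T_exact_X A B D Y (f : hom A B) (g : hom B D) : T_exact T f g -> X Y ->
  forall y : hom Y B, g \oc y = 0 -> exists x, f \oc x = y.
Proof.
move=> ex /X_coordinates [n [s [p sp]]] y gy.
have /choice [x Hx] i : exists x, f \oc x = y \oc p i.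
  by apply/ex; rewrite compA gy comp0m.
exists (\sum_i x i \oc s i); rewrite comp_sumr -[RHS](compm1 y) -sp comp_sumr.
by apply: eq_bigr => i _; rewrite !compA Hx.
Qed.

Lemma T_surj_X A B Y (f : hom A B) (y : hom Y B) : T_surj T f -> X Y ->
  exists x, f \oc x = y.
Proof.
move=> sf XY; have [Z Z0] := abelian_zero Cab.
apply: (@T_exact_X _ _ _ _ _ (0 : hom B Z)) => //; last by rewrite comp0m.
by move=> z; rewrite comp0m; split.
Qed.

Lemma T_zero_X Y A (f : hom Y A) : X Y ->
  (forall x : hom T Y, f \oc x = 0) -> f = 0.
Proof.
move=> /X_coordinates [n [s [p sp]]] f0.
rewrite -(compm1 f) -sp comp_sumr big1 // => i _.
by rewrite compA f0 comp0m.
Qed.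

Lemma T_surj_epi A B (f : hom A B) : T_surj T f -> epi f.
Proof.
move=> sf; apply: epi_projP => P y Pp.
by apply: T_surj_X => //; exact: resolving_proj RX _ Pp.
Qed.

(** Projectives lie in [X], so lifting from T gives lifting from them; as [A] is in [X], the
    composite vanishes once it does on maps from T. *)
Lemma T_exact_exact A B D (f : hom A B) (g : hom B D) : X A -> T_exact T f g ->
  exact f g.
Proof.
move=> XA ex; apply/exactP; split=> [|P y Pp gy].
  apply: T_zero_X => // x; rewrite -compA; apply/ex; by exists x.
by apply: T_exact_X ex _ _ gy; exact: resolving_proj RX _ Pp.
Qed.

Lemma approximation A : exists Y (f : hom Y A), X Y /\ T_surj T f.
Proof.
have [n [g Hg]] := gen A; have [S XS [inj [prj [pii pij e]]]] := power n.
exists S, (\sum_i g i \oc prj i); split=> // y; have [a ->] := Hg y.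
exists (\sum_i inj i \oc a i); rewrite comp_suml; apply: eq_bigr => i _.
by rewrite -compA direct_sum_prj.
Qed.

(** ** Finitely presented modules *)

(** Generators of Hom(T, A) define T^n -> A; generators of Hom(T, K) for its kernel K give the
    relations. *)
Lemma fin_presented_hom A : fin_presented (hom_mod T A).
Proof.
have [n [g Hg]] := gen A; have [S XS [inj [prj [pii pij e]]]] := power n.
have [K [k kG]] := abelian_ker Cab (\sum_i g i \oc prj i).
have [m [h Hh]] := gen K.
pose w j : 'rV[endo_op T]_n := \row_i (prj i \oc k \oc h j).
have [f Ef] := row_linear_map w.
have [q Eq] := @row_linear_map _ (hom_mod T A) _ g.
have qE v : q v = (\sum_i g i \oc prj i) \oc (\sum_i inj i \oc v 0 i).
  rewrite Eq comp_suml; apply: eq_bigr => i _.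
  by rewrite -compA direct_sum_prj.
have fE u i : f u 0 i = prj i \oc (k \oc \sum_j h j \oc u 0 j).
  rewrite Ef summxE !comp_sumr; apply: eq_bigr => j _.
  by rewrite !mxE !compA.
exists m, n, f, q; split=> [v | y].
  rewrite qE; split=> [/(kernel_lift kG) [x ex] | [u <-]].
    have [a ea] := Hh x; exists (\row_j a j); apply/rowP => i.
    rewrite fE; under eq_bigr do rewrite mxE.
    by rewrite -ea ex direct_sum_prj.
  have -> : \sum_i inj i \oc f u 0 i = k \oc \sum_j h j \oc u 0 j.
    rewrite -[RHS]comp1m -e comp_suml; apply: eq_bigr => i _.
    by rewrite fE compA.
  by rewrite compA (kernel_comp0 kG) comp0m.
have [a ->] := Hg y; exists (\row_i a i); rewrite Eq.
by apply: eq_bigr => i _; rewrite mxE.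
Qed.

Lemma fp_projective_hom Y : X Y -> fp_projective (hom_mod T Y).
Proof.
move=> /X_coordinates [n [s [p sp]]]; split; first exact: fin_presented_hom.
by move=> M N e f _ _; exact: coordinates_lift sp.
Qed.

(** For a direct sum S of n copies of T this identifies Hom(T, S) with the free module of rank n. *)
Lemma power_row n S (prj : 'I_n -> hom S T) :
  exists phi : {linear hom_mod T S -> 'rV[endo_op T]_n},
    forall x, phi x = \row_i (prj i \oc x).
Proof.
apply: linear_map => a x y; apply/rowP => i.
by rewrite !mxE compDr hom_mod_scale compA.
Qed.

Lemma power_row_surj n S (inj : 'I_n -> hom T S) (prj : 'I_n -> hom S T)
    (v : 'rV[endo_op T]_n) :
  (forall i, prj i \oc inj i = idm T) ->
  (forall i j, i != j -> prj i \oc inj j = 0) ->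
  \row_i (prj i \oc \sum_j inj j \oc v 0 j) = v.
Proof. by move=> pii pij; apply/rowP => i; rewrite mxE direct_sum_prj. Qed.

Definition represents Y (M : lmodType (endo_op T)) : Prop :=
  exists (a : {linear M -> hom_mod T Y}) (b : {linear hom_mod T Y -> M}),
    cancel a b /\ cancel b a.

(* P is a retract of some Hom(T, T^n); the corresponding idempotent of T^n
   splits in the abelian category. *)
Lemma fp_projective_represented (P : lmodType (endo_op T)) :
  fp_projective P -> exists2 Y, X Y & represents Y P.
Proof.
move=> [[m [n [f [g [fg sg]]]]] lift].
have [S XS [inj [prj [pii pij e]]]] := power n.
have [phi Ephi] := power_row prj.
have [q Eq] : exists q : {linear hom_mod T S -> P}, forall x, q x = g (phi x).
  by apply: linear_map => a x y; rewrite !linearP.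
have sq : lin_surj q.
  move=> y; have [v <-] := sg y; exists (\sum_j inj j \oc v 0 j).
  by rewrite Eq Ephi power_row_surj.
have fpS := fin_presented_hom S.
have fpP : fin_presented P by exists m, n, f, g.
have [id1 Eid] : exists h : {linear P -> P}, forall x, h x = x.
  by apply: linear_map => a x y.
have [s Es] := lift _ _ q id1 fpS fpP sq.
have qs x : q (s x) = x by rewrite Es Eid.
have [eps Eeps] : exists h : {linear hom_mod T S -> hom_mod T S},
    forall x, h x = s (q x).
  by apply: linear_map => a x y; rewrite !linearP.
have [k [t [p tp]]] := X_coordinates XS.
have [c Ec] := yoneda eps tp.
have Ec' x : c \oc x = s (q x) by rewrite -Ec Eeps.
have cc : c \oc c = c.
  apply/subr0_eq/(T_zero_X XS) => x.
  by rewrite compDl compNl -compA !Ec' qs subrr.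
(* The kernel of 1 - c is the image of the idempotent [c]. *)
have [Y [j jY]] := abelian_ker Cab (idm S - c).
have cj : c \oc j = j.
  by apply/esym/subr0_eq; rewrite -{1}(comp1m j) -compNl -compDl (kernel_comp0
    jY).
have : (idm S - c) \oc c = 0 by rewrite compDl compNl comp1m cc subrr.
move=> /(kernel_lift jY) [r jr].
have rj : r \oc j = idm Y.
  by apply: (kernel_mono jY); rewrite compA jr cj compm1.
exists Y; first exact: resolving_retract rj XS.
have [r1 Er] := postcomp_linear T r; have [j1 Ej] := postcomp_linear T j.
have [a Ea] : exists a : {linear P -> hom_mod T Y}, forall x, a x = r \oc s x.
  apply: linear_map => b x y; rewrite linearP -!Er.
  by rewrite linearP.
have [b Eb] : exists b : {linear hom_mod T Y -> P}, forall x, b x = q (j \oc x).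
  apply: linear_map => d x y; rewrite -!Ej.
  by rewrite !linearP.
exists a, b; split=> x.
  by rewrite Eb Ea compA jr Ec' !qs.
by rewrite Ea Eb -Ec' (compA c) cj compA rj comp1m.
Qed.
(** ** Global dimension *)

(** A projective resolution of Hom(T, A) is transported to C: objects of [X] represent its terms,
    Yoneda gives its maps, and exactness on maps from T implies exactness. *)
Lemma gldim_resdim : finite_gldim (endo_op T) -> finite_resdim X.
Proof.
move=> [n H]; exists n => A.
have [m lemn [P [d [e [Pfp P0 se ex0 ex]]]]] := H _ (fin_presented_hom A).
exists m => //.
have [Z Z0] := abelian_zero Cab.
have rep i : exists Y, [/\ X Y, represents Y (P i) & (m < i)%N -> zero_object
  Y].
  have [leim | ltmi] := leqP i m.
    by have [Y XY rY] := fp_projective_represented (Pfp i leim); exists Y.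
  (* Beyond degree [m] the modules vanish, and zero maps represent them by a zero object. *)
  exists Z; split=> //; first exact: resolving_zero RX _ Z0.
  have [a _] := @linear_map _ (P i) (hom_mod T Z) (fun _ => 0)
    (fun b x y => esym (etrans (addr0 _) (scaler0 _ b))).
  have [b _] := @linear_map _ (hom_mod T Z) (P i) (fun _ => 0)
    (fun b x y => esym (etrans (addr0 _) (scaler0 _ b))).
  exists a, b; split=> x; first by rewrite (P0 i ltmi (b _)) (P0 i ltmi x).
  exact: (etrans (zero_codom (_ : hom T Z) Z0) (esym (zero_codom _ Z0))).
have [Y HY] := choice rep.
have XY i : X (Y i) by case: (HY i).
have rY i : represents (Y i) (P i) by case: (HY i).
pose a i := sval (cid (rY i)).
pose b i := sval (cid (svalP (cid (rY i)))).
have [ab ba] : (forall i, cancel (a i) (b i)) /\ (forall i, cancel (b i) (a i)).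
  by split=> i; have [] := svalP (cid (svalP (cid (rY i)))).
have Hd i : exists D : hom (Y i.+1) (Y i),
    forall x : hom T (Y i.+1), D \oc x = a i (d i (b i.+1 x)).
  have [k [t [p tp]]] := X_coordinates (XY i.+1).
  have [h Eh] : exists h : {linear hom_mod T (Y i.+1) -> hom_mod T (Y i)},
      forall x, h x = a i (d i (b i.+1 x)).
    by apply: linear_map => r x y; rewrite !linearP.
  by have [D ED] := yoneda h tp; exists D => x; rewrite -ED Eh.
pose D i := sval (cid (Hd i)).
have ED i (x : hom T (Y i.+1)) : D i \oc x = a i (d i (b i.+1 x)).
  exact: (svalP (cid (Hd i))).
have [E EE] : exists E : hom (Y 0%N) A,
    forall x : hom T (Y 0%N), E \oc x = e (b 0%N x).
  have [k [t [p tp]]] := X_coordinates (XY 0%N).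
  have [h Eh] : exists h : {linear hom_mod T (Y 0%N) -> hom_mod T A},
      forall x, h x = e (b 0%N x).
    by apply: linear_map => r x y; rewrite !linearP.
  by have [E EE] := yoneda h tp; exists E => x; rewrite -EE Eh.
exists Y, D, E; split=> //.
- by move=> i; case: (HY i).
- apply: T_surj_epi => y; have [x <-] := se y.
  by exists (a 0%N x); rewrite EE ab.
- apply: T_exact_exact => // y; rewrite EE; split=> [/ex0 [x ex1] | [x <-]].
    by exists (a 1%N x); rewrite ED ab ex1 ba.
  by rewrite ED ab; apply/ex0; exists (b 1%N x).
- move=> i; apply: T_exact_exact => // y; rewrite ED.
  have a0 j x : a j x = 0 <-> x = 0.
    by split=> [ax | ->]; [rewrite -(ab j x) ax|]; rewrite linear0.
  split=> [/a0 /ex [x ex1] | [x <-]].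
    by exists (a i.+2 x); rewrite ED ab ex1 ba.
  by apply/a0; rewrite ED ab; apply/ex; exists (b i.+2 x).
Qed.

(** * Resolutions built from approximations *)

Definition cons_obj Y (F : nat -> C) (i : nat) : C :=
  if i is j.+1 then F j else Y.

Definition cons_diff Y (F : nat -> C) (d : forall i, hom (F i.+1) (F i))
    (f : hom (F 0%N) Y) (i : nat) : hom (cons_obj Y F i.+1) (cons_obj Y F i) :=
  match i with 0%N => f | j.+1 => d j end.

(** Surjectivity of [e] on maps from T is kept apart, so that a chain may also end in a map that is
    not an approximation. *)
Definition T_chain (n : nat) (F : nat -> C)
    (d : forall i, hom (F i.+1) (F i)) A (e : hom (F 0%N) A) : Prop :=
  [/\ forall i, X (F i), forall i, (n < i)%N -> zero_object (F i),
      T_exact T (d 0%N) e & forall i, T_exact T (d i.+1) (d i)].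

Lemma T_chain_cons n F (d : forall i, hom (F i.+1) (F i)) K
    (e : hom (F 0%N) K) Y A (k : hom K Y) (g : hom Y A) :
  T_chain n d e -> T_surj T e -> is_kernel g k -> X Y ->
  T_chain n.+1 (cons_diff d (k \oc e)) (g : hom (cons_obj Y F 0%N) A).
Proof.
move=> [XF ZF ex0 ex] se kg XY; split=> [[]//|[]//| y | [|i] y /=].
- rewrite /=; split=> [/(kernel_lift kg) [x <-] | [x <-]].
    by have [z <-] := se x; exists z; rewrite compA.
  by rewrite !compA (kernel_comp0 kg) !comp0m.
- rewrite -compA; split=> [ke0 | /ex0 ->]; last by rewrite compm0.
  apply/ex0; move/monoP: (kernel_mono kg); exact.
- exact: ex.
Qed.

(** The given resolution is replaced by iterated approximations; by [resd_syzygy] each kernel has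
    smaller resolution dimension. *)
Lemma resd_T_chain n A : resd X n A ->
  exists F (d : forall i, hom (F i.+1) (F i)) (e : hom (F 0%N) A),
    T_chain n d e /\ T_surj T e.
Proof.
elim: n A => [|n IH] A XA.
  have [Z Z0] := abelian_zero Cab.
  exists (cons_obj A (fun _ => Z)), (cons_diff (fun _ => 0) 0), (idm A).
  split; last by move=> y; exists y; rewrite comp1m.
  split=> [[|i]|[|i]|y|[|i] y] //=; first exact: resolving_zero RX _ Z0.
  - rewrite comp1m; split=> [-> | [x <-]]; last by rewrite comp0m.
    by exists 0; rewrite compm0.
  - split=> [_ | _]; last by rewrite comp0m.
    by exists 0; rewrite compm0 (zero_codom y).
  - split=> [_ | _]; last by rewrite comp0m.
    by exists 0; rewrite compm0 (zero_codom y).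
have [Y [f [XY sf]]] := approximation A.
have [K [k kf]] := epi_ses (T_surj_epi sf).
have [F [d [e [ch se]]]] := IH K (resd_syzygy RX kf XY XA).
exists (cons_obj Y F), (cons_diff d (k \oc e)), f; split=> //.
by apply: T_chain_cons => //; case: kf.
Qed.

(** A presentation of M is a map [phi] from T^m to T^l. With T^l in degree 0 and T^m in degree 1, a
    chain of length n for its kernel fills degrees 2 to n + 2. *)
Lemma resdim_gldim : finite_resdim X -> finite_gldim (endo_op T).
Proof.
move=> /(finite_resdim_resd RX) [n H]; exists n.+2 => M fpM; exists n.+2 => //.
have [m [l [f [g [fg sg]]]]] := fpM.
have [S XS [inj [prj [pii pij eS]]]] := power m.
have [S' XS' [inj' [prj' [pii' pij' eS']]]] := power l.
pose phi : hom S S' :=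
  \sum_i inj' i \oc (\sum_j f (delta_mx 0 j) 0 i \oc prj j).
(* Multiplication in the converse ring is reversed, so the row-vector action of [f] becomes
   composition with its matrix entries on the left. *)
have fE (v : 'rV[endo_op T]_m) i :
    f v 0 i = \sum_j (f (delta_mx 0 j) 0 i : hom T T) \oc v 0 j.
  rewrite {1}(row_sum_delta v) linear_sum summxE; apply: eq_bigr => j _.
  by rewrite linearZ mxE.
have phiE (x : hom T S) i : prj' i \oc (phi \oc x) = f (\row_j (prj j \oc x))
  0 i.
  rewrite fE compA direct_sum_prj // comp_suml; apply: eq_bigr => j _.
  by rewrite mxE compA.
have [K [k kphi]] := abelian_ker Cab phi.
have [F [d [e [ch se]]]] := resd_T_chain (H K).
have [XF ZF ex0 ex] := T_chain_cons ch se kphi XS.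
pose F' := cons_obj S' (cons_obj S F).
pose d' : forall i, hom (F' i.+1) (F' i) := cons_diff (cons_diff d (k \oc e))
  phi.
have [q Eq] : exists q : {linear hom_mod T S' -> M},
    forall x, q x = g (\row_i (prj' i \oc x)).
  have [r Er] := power_row prj'.
  by apply: linear_map => a x y; rewrite -!Er !linearP.
pose D i := sval (cid (postcomp_linear T (d' i))).
have ED i (x : hom T (F' i.+1)) : D i x = d' i \oc x.
  exact: (svalP (cid (postcomp_linear T (d' i)))).
exists (fun i => hom_mod T (F' i)), D, q; split.
- by move=> [|i] _; apply: fp_projective_hom => //=; apply: XF.
- by move=> [|i] // ltni x; apply: zero_codom; apply: ZF.
- move=> y; have [v <-] := sg y; exists (\sum_i inj' i \oc v 0 i).
  by rewrite Eq power_row_surj.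
- move=> x; rewrite Eq; split=> [/fg [u eu] | [y <-]].
    exists (\sum_j inj j \oc u 0 j); rewrite ED /=.
    apply/subr0_eq/(direct_sum_mono eS') => i.
    by rewrite compDr compNr phiE power_row_surj // eu mxE subrr.
  apply/fg; exists (\row_j (prj j \oc y)); apply/rowP => i.
  by rewrite mxE ED /= phiE.
- move=> [|i] x; split=> [|[y <-]]; rewrite ?ED.
  + by move=> /ex0 [y <-]; exists y; rewrite ED.
  + by apply/ex0; exists y.
  + by move=> /ex [y <-]; exists y; rewrite ED.
  + by apply/ex; exists y.
Qed.

End Add.

(** * Identification with the Gorenstein-projectives and the equivalences *)

Lemma gproj_eq_resolving (X : C -> Prop) : resolving X ->
  subcategory_of X (@gproj C) -> finite_resdim X -> X = @gproj C.
Proof.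
move=> RX sX fX; apply/predeqP => G; split; first exact: sX.
exact: gproj_sub_resolving.
Qed.

End Abelian.

Theorem corollary6p13 (C : preadditive) (C_abelian : abelian C)
    (C_enough : enough_projectives C) :
  (gorenstein C <->
   exists X : C -> Prop,
     [/\ resolving X, subcategory_of X (@gproj C) & finite_resdim X])
  /\
  (gorenstein C /\ finite_CM_type C <->
   exists X : C -> Prop,
     [/\ resolving X, subcategory_of X (@gproj C), finite_rep_type X
       & finite_resdim X])
  /\
  (forall (R : comPzRingType) (L : linear_structure R C),
     (forall A B : C, hom_fin_generated L A B) ->
     (gorenstein C /\ finite_CM_type C <->
      exists X : C -> Prop,
        [/\ resolving X, subcategory_of X (@gproj C), finite_rep_type X
          & exists T : C, (forall A : C, X A <-> add_closure T A) /\
                          finite_gldim (endo_op T)])).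
Proof.
have RG := gproj_resolving C_abelian C_enough.
have eqG := gproj_eq_resolving C_abelian C_enough.
(* Finite type passes between [X] and the Gorenstein-projectives because the two predicates are
   equal. *)
have ii : gorenstein C /\ finite_CM_type C <-> exists X : C -> Prop,
    [/\ resolving X, subcategory_of X (@gproj C), finite_rep_type X
      & finite_resdim X].
  split=> [[gC fC] | [X [RX sX fX dX]]]; first by exists (@gproj C); split=>
    // A.
  by have e := eqG X RX sX dX; split; rewrite /gorenstein /finite_CM_type -e.
split; [| split=> // R L fg].
  split=> [gC | [X [RX sX [n dX]]]]; first by exists (@gproj C); split=> // A.
  (* A resolution by objects of [X] is one by Gorenstein-projectives. *)
  exists n => A; have [m lemn [F [d [e [XF ZF ee ex0 ex]]]]] := dX A.
  by exists m => //; exists F, d, e; split=> // i /XF /sX.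
(* Finite generation over R provides the right approximations. *)
have gen (T A : C) : hom_generated T A by exact: (fin_generated_hom (fg T A)).
split=> [[gC fC] | [X [RX sX fX [T [addX gT]]]]].
  have [T addT] := finite_rep_type_add C_abelian C_enough RG fC.
  exists (@gproj C); split=> //; exists T; split=> //.
  exact: (resdim_gldim C_abelian C_enough RG addT (gen T)).
apply/ii; exists X; split=> //.
exact: (gldim_resdim C_abelian C_enough RX addX (gen T)).
Qed.
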